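(* For each nonnegative integer $k$, the map $\pi\mapsto\mathrm{DL}_k(\mathrm{swl}(\pi))$ restricted to $\mathcal U_{2k+1}(132,231)$ is a bijection from $\mathcal U_{2k+1}(132,231)$ to $\mathrm{Int}(\mathcal A_k)=\{(\Lambda,\Lambda):\Lambda\in\mathbf D_k\}$. Hence $|\mathcal U_{2k+1}(132,231)|=C_k=\frac{1}{k+1}\binom{2k}{k}$.
   Context: Permutations are finite words of distinct positive integers; $S_n$ is the set of permutations of $[n]$. The stack-sorting map $s$: $s(\text{empty})=\text{empty}$, and if $\pi=LnR$ with $n$ the largest entry, $s(\pi)=s(L)s(R)n$. $\pi$ is uniquely sorted if it has exactly one preimage under $s$. A permutation avoids $\tau$ if no subsequence has the same relative order as $\tau$; $\mathcal U_n(\tau^{(1)},\dots)$ is the set of uniquely sorted permutations in $S_n$ avoiding the listed patterns. A descent of $\pi$ is an index $i$ with $\pi_i>\pi_{i+1}$; $\mathrm{Des}(\pi)$ is the set of descents. $\mathrm{rot}(\pi)=\mathrm{rev}(\pi^{-1})$, where $\mathrm{rev}$ reverses the word and $\pi^{-1}$ is the group inverse; $\mathrm{rot}^{-1}$ is its inverse. Sliding operators: for $\pi\in S_n$, $i\in[n]$, let $L_i$ (resp. $R_i$) be the set of elements of $[i-1]$ to the left (resp. right) of the entry $i$ in $\pi$. $\mathrm{swu}_i(\pi)$ has $j$-th entry $\pi_j$ if $\pi_j\ge i$, $m$ if $\pi_j$ is the $m$-th smallest element of $R_i$, and $i-m$ if $\pi_j$ is the $m$-th largest element of $L_i$. $\mathrm{swl}_i=\mathrm{rot}^{-1}\circ\mathrm{swu}_i\circ\mathrm{rot}$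 and $\mathrm{swl}=\mathrm{swl}_1\circ\cdots\circ\mathrm{swl}_n$ on $S_n$. $\mathbf D_k$ is the set of Dyck paths of semilength $k$ (words in $\{U,D\}$ with $k$ of each letter, every prefix having at least as many $U$'s as $D$'s); $\mathcal A_k$ is the antichain on $\mathbf D_k$; $\mathrm{Int}(P)$ is the set of pairs $(x,y)$ with $x\le y$ in $P$. For $\pi\in\mathcal U_{2k+1}(312)$, $n=2k+1$, let $\Lambda_i=D$ if $n-i\in\mathrm{Des}(\pi)$ and $U$ otherwise, $\Lambda'_i=U$ if $i\in\mathrm{Des}(\mathrm{rot}(\pi))$ and $D$ otherwise ($1\le i\le 2k$), and $\mathrm{DL}_k(\pi)=(\Lambda_1\cdots\Lambda_{2k},\Lambda'_1\cdots\Lambda'_{2k})$. *)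

(* Defs.v *)
From mathcomp Require Import all_boot all_fingroup all_algebra.
From mathcomp Require Import zify.

Set Implicit Arguments.
Unset Strict Implicit.
Unset Printing Implicit Defensive.

(* A permutation of [n] is an element p of 'S_n.  Library ordinals are         *)
(* 0-based: the ordinal j stands for the position or value j + 1, and          *)
(* [word p] is the usual 1-based one-line notation of p.                       *)
Definition word n (p : 'S_n) : seq nat := [seq (p j).+1 | j <- enum 'I_n].

Definition max_entry (w : seq nat) : nat := \max_(x <- w) x.

(* The fuel [size w] always suffices: see [stack_sort_nil] and                 *)
(* [stack_sort_cat] for the defining equations.                                *)
Fixpoint stack_sort_rec (fuel : nat) (w : seq nat) : seq nat :=
  if fuel isn't m.+1 then [::] else
  if w is [::] then [::] else
  let n := max_entry w in
  let i := index n w in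
  stack_sort_rec m (take i w) ++ stack_sort_rec m (drop i.+1 w) ++ [:: n].

Definition stack_sort (w : seq nat) : seq nat := stack_sort_rec (size w) w.

(* Only rearrangements of w can be sent to w by [stack_sort], so it is enough  *)
(* to count preimages among these: see [uniquely_sortedP].                     *)
Definition uniquely_sorted (w : seq nat) : bool :=
  count (fun v => stack_sort v == w) (permutations w) == 1.

Definition same_order (u t : seq nat) : bool :=
  (size u == size t) &&
  [forall a : 'I_(size t), forall b : 'I_(size t),
     (nth 0 u a < nth 0 u b) == (nth 0 t a < nth 0 t b)].

(* The subsequences of w are the words [mask m w] with [size m = size w].      *)
Definition avoids (w t : seq nat) : bool :=
  [forall m : (size w).-tuple bool, ~~ same_order (mask m w) t].

Definition uniquely_sorted_av n (ts : seq (seq nat)) : {set 'S_n} :=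
  [set p | uniquely_sorted (word p) & all (avoids (word p)) ts].

(* i is the 1-based index of a descent of w.                                   *)
Definition is_descent (w : seq nat) (i : nat) : bool :=
  (0 < i < size w) && (nth 0 w i < nth 0 w i.-1).

Definition rev_perm n : 'S_n := perm (@rev_ord_inj n).

(* [(s * t)%g j = t (s j)], so this maps the position j to                     *)
(* [p^-1 (rev_ord j)], i.e. it reverses the word of the inverse.               *)
Definition perm_rot n (p : 'S_n) : 'S_n := (rev_perm n * p^-1)%g.

Definition perm_rot_inv n (p : 'S_n) : 'S_n := (p^-1 * rev_perm n)%g.

Definition left_smaller n (i : 'I_n) (p : 'S_n) : {set 'I_n} :=
  [set x : 'I_n | (x < i) && ((p^-1)%g x < (p^-1)%g i)].

Definition right_smaller n (i : 'I_n) (p : 'S_n) : {set 'I_n} :=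
  [set x : 'I_n | (x < i) && ((p^-1)%g i < (p^-1)%g x)].

Definition rank_from_bottom n (A : {set 'I_n}) (v : 'I_n) : nat :=
  #|[set x in A | x <= v]|.

Definition rank_from_top n (A : {set 'I_n}) (v : 'I_n) : nat :=
  #|[set x in A | v <= x]|.

(* With 0-based values the new entry m becomes m - 1; the new entry i - m      *)
(* keeps its form because i is shifted as well.                                *)
Definition swu_val n (i : 'I_n) (p : 'S_n) (j : 'I_n) : nat :=
  let v := p j in
  if i <= v then v : nat
  else if v \in right_smaller i p then
    (rank_from_bottom (right_smaller i p) v).-1
  else i - rank_from_top (left_smaller i p) v.

Lemma rank_from_bottom_gt0 n (A : {set 'I_n}) v :
  v \in A -> 0 < rank_from_bottom A v.
Proof. by move=> vA; apply/card_gt0P; exists v; rewrite inE vA /=. Qed.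

Lemma rank_from_top_gt0 n (A : {set 'I_n}) v :
  v \in A -> 0 < rank_from_top A v.
Proof. by move=> vA; apply/card_gt0P; exists v; rewrite inE vA /=. Qed.

Lemma rank_from_bottom_le n (A : {set 'I_n}) v : rank_from_bottom A v <= #|A|.
Proof. by apply/subset_leq_card/subsetP => x; rewrite inE => /andP[]. Qed.

Lemma rank_from_top_le n (A : {set 'I_n}) v : rank_from_top A v <= #|A|.
Proof. by apply/subset_leq_card/subsetP => x; rewrite inE => /andP[]. Qed.

Lemma rank_from_bottom_lt n (A : {set 'I_n}) (a b : 'I_n) :
  b \in A -> a < b -> rank_from_bottom A a < rank_from_bottom A b.
Proof.
move=> bA ab; apply: proper_card; apply/properP; split.
  apply/subsetP => x; rewrite !inE => /andP[-> xa] /=.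
  exact: leq_trans xa (ltnW ab).
by exists b; rewrite !inE bA //= -ltnNge.
Qed.

Lemma rank_from_top_lt n (A : {set 'I_n}) (a b : 'I_n) :
  a \in A -> a < b -> rank_from_top A b < rank_from_top A a.
Proof.
move=> aA ab; apply: proper_card; apply/properP; split.
  apply/subsetP => x; rewrite !inE => /andP[-> xa] /=.
  exact: leq_trans (ltnW ab) xa.
by exists a; rewrite !inE aA //= -ltnNge.
Qed.

Lemma card_left_right n (i : 'I_n) (p : 'S_n) :
  #|left_smaller i p| + #|right_smaller i p| <= i.
Proof.
have dis : [disjoint left_smaller i p & right_smaller i p].
  rewrite -setI_eq0; apply/eqP/setP => x; rewrite !inE; apply/negbTE.
  by apply/negP => /andP[/andP[_ a] /andP[_ b]]; lia.
rewrite -cardsUI (disjoint_setI0 dis) cards0 addn0.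
apply: leq_trans (_ : #|[set widen_ord (ltnW (ltn_ord i)) j | j : 'I_i]| <= _).
  apply/subset_leq_card/subsetP => x; rewrite !inE => h.
  have xi : x < i by case/orP: h => /andP[].
  by apply/imsetP; exists (Ordinal xi) => //; apply: val_inj.
by apply: leq_trans (leq_imset_card _ _) _; rewrite card_ord.
Qed.

Lemma left_smallerE n (i : 'I_n) (p : 'S_n) (v : 'I_n) :
  v < i -> (v \in left_smaller i p) = (v \notin right_smaller i p).
Proof.
move=> vi; rewrite !inE vi /= -leqNgt ltn_neqAle.
have -> // : nat_of_ord ((p^-1)%g v) != (p^-1)%g i.
by apply: contraTneq vi => /val_inj/perm_inj ->; rewrite ltnn.
Qed.

Lemma swu_val_lt n (i : 'I_n) (p : 'S_n) j : swu_val i p j < n.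
Proof.
rewrite /swu_val; case: (leqP i (p j)) => [_|vi]; first exact: ltn_ord.
have := card_left_right i p; have := ltn_ord i.
case: ifP => vR; last by lia.
by have := rank_from_bottom_le (right_smaller i p) (p j); lia.
Qed.

Definition swu_fun n (i : 'I_n) (p : 'S_n) (j : 'I_n) : 'I_n :=
  Ordinal (swu_val_lt i p j).

Lemma swu_fun_inj n (i : 'I_n) (p : 'S_n) : injective (swu_fun i p).
Proof.
move=> j1 j2 /(congr1 (@nat_of_ord n)) /=; rewrite /swu_val => e.
apply: (@perm_inj _ p); apply: ord_inj; move: e.
move: (p j1 : 'I_n) (p j2 : 'I_n) => v1 v2.
have := @left_smallerE _ i p.
have := @rank_from_top_lt _ (left_smaller i p).
have := @rank_from_bottom_lt _ (right_smaller i p).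
have := @rank_from_top_gt0 _ (left_smaller i p).
have := @rank_from_bottom_gt0 _ (right_smaller i p).
have := @rank_from_top_le _ (left_smaller i p).
have := @rank_from_bottom_le _ (right_smaller i p).
have := card_left_right i p.
move: (rank_from_bottom _) (rank_from_top _) => rb rt.
move: #|left_smaller i p| #|right_smaller i p| => cl cr.
move=> C B T B0 T0 BL TL LR.
case: (leqP i v1) => h1; case: (leqP i v2) => h2 //.
- by case: ifP (LR v2 h2) => r /= l; [have := B v2 | have := T0 _ l]; lia.
- by case: ifP (LR v1 h1) => r /= l; [have := B v1 | have := T0 _ l]; lia.
case: ifP (LR _ h1) => r1 l1; case: ifP (LR _ h2) => r2 l2 e.
- have b1 := B0 _ r1; have b2 := B0 _ r2.
  case: (ltngtP v1 v2) => // v12.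
    by have := BL _ _ r2 v12; lia.
  by have := BL _ _ r1 v12; lia.
- by have := B v1; have := B0 _ r1; have := T v2; lia.
- by have := B v2; have := B0 _ r2; have := T v1; lia.
- have t1 := T v1; have t2 := T v2.
  case: (ltngtP v1 v2) => // v12.
    by have := TL _ _ l1 v12; lia.
  by have := TL _ _ l2 v12; lia.
Qed.

Definition swu n (i : 'I_n) (p : 'S_n) : 'S_n := perm (@swu_fun_inj n i p).

Definition swl_at n (i : 'I_n) (p : 'S_n) : 'S_n :=
  perm_rot_inv (swu i (perm_rot p)).

(* As in the composition swl_1 o ... o swl_n, the last index acts first.       *)
Definition swl n (p : 'S_n) : 'S_n :=
  foldr (fun i q => swl_at i q) p (enum 'I_n).

Notation step := bool (only parsing).
Notation Up := true (only parsing).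
Notation Down := false (only parsing).

Definition Dyck k : {set (2 * k).-tuple step} :=
  [set w : (2 * k).-tuple step |
     [&& count_mem Up w == k, count_mem Down w == k &
      [forall m : 'I_(2 * k).+1,
         count_mem Down (take m w) <= count_mem Up (take m w)]]].

Definition intervals (T : finType) (P : {set T}) (le : rel T) : {set T * T} :=
  [set xy | [&& xy.1 \in P, xy.2 \in P & le xy.1 xy.2]].

Definition antichain_le (T : eqType) : rel T := fun x y => x == y.

(* The library index [i < 2 * k] is the 1-based index i + 1.                   *)
Definition DL k (p : 'S_(2 * k).+1) :
    (2 * k).-tuple step * (2 * k).-tuple step :=
  ([tuple (if is_descent (word p) ((2 * k).+1 - i.+1) then Down else Up)
     | i < 2 * k],
   [tuple (if is_descent (word (perm_rot p)) i.+1 then Up else Down)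
     | i < 2 * k]).

Lemma perm_rotK n : cancel (@perm_rot n) (@perm_rot_inv n).
Proof.
by move=> p; rewrite /perm_rot_inv /perm_rot invMg invgK -mulgA mulVg mulg1.
Qed.

Lemma perm_rot_invK n : cancel (@perm_rot_inv n) (@perm_rot n).
Proof.
by move=> p; rewrite /perm_rot_inv /perm_rot invMg invgK mulgA mulgV mul1g.
Qed.

Lemma size_word n (p : 'S_n) : size (word p) = n.
Proof. by rewrite size_map size_enum_ord. Qed.

Lemma word_perm_rot n (p : 'S_n) : word (perm_rot p) = rev (word (p^-1)%g).
Proof.
apply: (@eq_from_nth _ 0) => [|a]; rewrite ?size_rev !size_word // => an.
have rn : n - a.+1 < n by lia.
have nthw (q : 'S_n) b (bn : b < n) :
    nth 0 (word q) b = (q (Ordinal bn)).+1.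
  rewrite /word (nth_map (Ordinal bn)) ?size_enum_ord //; congr (nat_of_ord (q _)).+1.
  by apply: val_inj; rewrite /= nth_enum_ord.
rewrite nth_rev size_word // !nthw permM.
have -> // : rev_perm n (Ordinal an) = Ordinal rn.
by rewrite permE; apply: val_inj.
Qed.

Lemma max_entry_mem x w : max_entry (x :: w) \in x :: w.
Proof.
rewrite /max_entry; elim: w x => [|y w IH] x.
  by rewrite big_seq1 mem_head.
rewrite big_cons; have := IH y; set m := \big[_/_]_(z <- _) z => mw.
by case: (leqP x m) => h; rewrite inE ?mw ?orbT ?eqxx.
Qed.

Lemma stack_sort_recS m w (n := max_entry w) (i := index n w) :
    0 < size w ->
  [/\ stack_sort_rec m.+1 w =
        stack_sort_rec m (take i w) ++ stack_sort_rec m (drop i.+1 w) ++ [:: n],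
      w = take i w ++ n :: drop i.+1 w,
      size (take i w) < size w & size (drop i.+1 w) < size w].
Proof.
case: w @n @i => // x w n i _.
have iw : i < size (x :: w) by rewrite index_mem max_entry_mem.
have e : x :: w = take i (x :: w) ++ n :: drop i.+1 (x :: w).
  rewrite -[LHS](cat_take_drop i); congr (_ ++ _).
  by rewrite (drop_nth 0 iw) nth_index ?max_entry_mem.
split => //; first by rewrite size_take iw.
by rewrite size_drop ltn_subrL.
Qed.

Lemma stack_sort_rec_fuel m w :
  size w <= m -> stack_sort_rec m w = stack_sort w.
Proof.
have [c] := ubnP (size w); elim: c m w => // c IH [|m] w wc wm.
  by case: w wm {wc}.
have [w0|] := posnP (size w); first by rewrite (size0nil w0).
move=> w0; have sw : size w = (size w).-1.+1 by rewrite prednK.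
rewrite /stack_sort sw; set m' := (size w).-1.
have [-> _ st sd] := stack_sort_recS m w0.
have [-> _ _ _] := stack_sort_recS m' w0.
by rewrite !(IH m) ?(IH m') // /m'; lia.
Qed.

Lemma stack_sort_nil : stack_sort [::] = [::].
Proof. by []. Qed.

Lemma stack_sort_cat (l r : seq nat) n :
    all (fun x => x < n) l -> all (fun x => x < n) r ->
  stack_sort (l ++ n :: r) = stack_sort l ++ stack_sort r ++ [:: n].
Proof.
move=> lln rln.
have mx : max_entry (l ++ n :: r) = n.
  rewrite /max_entry big_cat big_cons /=.
  have H s : all (fun x => x < n) s -> \max_(x <- s) x <= n.
    by move=> /allP sn; apply/bigmax_leqP_seq => x /sn /ltnW.
  by have := H _ lln; have := H _ rln; lia.
have ix : index n (l ++ n :: r) = size l.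
  rewrite index_cat /= eqxx addn0; case: ifP => // nl.
  by have := allP lln _ nl; rewrite ltnn.
have w0 : 0 < size (l ++ n :: r) by rewrite size_cat addnS.
rewrite -(@stack_sort_rec_fuel (size (l ++ n :: r)).+1) //.
have [-> _ st sd] := stack_sort_recS (size (l ++ n :: r)) w0.
rewrite !stack_sort_rec_fuel ?(ltnW st) ?(ltnW sd) // mx ix.
rewrite take_size_cat //.
by rewrite -(cat_rcons n l r) drop_size_cat ?size_rcons.
Qed.

Lemma perm_stack_sort w : perm_eq (stack_sort w) w.
Proof.
have [c] := ubnP (size w); elim: c w => // c IH w wc.
have [w0|w0] := posnP (size w); first by rewrite (size0nil w0).
rewrite -(@stack_sort_rec_fuel (size w).+1) //.
have [-> e st sd] := stack_sort_recS (size w) w0.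
rewrite !stack_sort_rec_fuel ?(ltnW st) ?(ltnW sd) //.
rewrite [X in perm_eq _ X]e; apply: perm_cat; first by apply: IH; lia.
by rewrite cats1 perm_rcons perm_cons; apply: IH; lia.
Qed.

Lemma uniquely_sortedP w :
  reflect (exists! v, stack_sort v = w) (uniquely_sorted w).
Proof.
have mem v : stack_sort v = w -> v \in permutations w.
  by move=> <-; rewrite mem_permutations perm_sym perm_stack_sort.
have uq : uniq [seq v <- permutations w | stack_sort v == w].
  exact/filter_uniq/permutations_uniq.
rewrite /uniquely_sorted -size_filter; apply: (iffP idP).
  case E: [seq _ <- _ | _] => [|v [|]] // _.
  have ev : forall u, (stack_sort u == w) = (u == v).
    move=> u; rewrite -(mem_seq1 u v) -E mem_filter.
    by case: eqP => //= /mem ->.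
  by exists v; split => [|u /eqP]; [apply/eqP; rewrite ev | rewrite ev => /eqP].
case=> v [ev uv].
suff /perm_size -> : perm_eq [seq u <- permutations w | stack_sort u == w] [:: v] by [].
apply: uniq_perm => // u; rewrite mem_filter mem_seq1.
by apply/andP/eqP => [[/eqP/uv ->] | ->] //; rewrite ev eqxx mem.
Qed.

Lemma avoidsP w t :
  reflect (forall u, subseq u w -> ~~ same_order u t) (avoids w t).
Proof.
apply: (iffP forallP) => [av u /subseqP[m sm ->] | av m].
  by have := av (Tuple (introT eqP sm)).
by apply: av; apply: mask_subseq.
Qed.

(* Main.v *)
Require Import Defs.
From mathcomp Require Import all_boot all_fingroup all_algebra.
From mathcomp Require Import zify.

(* If [stack_sort (l ++ n :: r)] has as many ascents as descents, then the     *)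
(* path of its steps read backwards is U P D Q, with P and Q the Dyck paths    *)
(* of [stack_sort r] and [stack_sort l].  First return makes the preimage      *)
(* unique; conversely, a missing descent allows a second preimage.  Hence w is *)
(* uniquely sorted iff it is sorted and has (n - 1) / 2 descents.              *)
(*                                                                             *)
(* Avoiding 132 and 231 means w = a ++ b with a decreasing, b increasing and   *)
(* b starting with 1.  Such a w is uniquely sorted iff, reading the values     *)
(* from n down to 2, with U for the entries of b and D for those of a, one     *)
(* gets a Dyck path.  The operator swl_i is the stable partition of the first  *)
(* i - 1 entries according to their comparison with the i-th one, so swl sends *)
(* w to the layered involution that reverses the blocks of 1, ..., n starting  *)
(* at the entries of b.  Both paths attached to it by DL_k are the Dyck path    *)
(* above, and a layered word whose steps form a Dyck path is sorted, again by  *)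
(* first-return decomposition.                                                 *)

Set Implicit Arguments.
Unset Strict Implicit.
Unset Printing Implicit Defensive.

(** * Steps of a word and the stack-sorting map *)

(** A word in the domain is a V: a decreasing part [a], then an increasing part [b] starting with 1.
    It is determined by which of the values 2, ..., 2k + 1 lie in [b], that is by the step word
    [dyck_word k b], and every step word arises in this way ([vshape_inj], [vshape_of_dyck_word]).
    By [uniquely_sortedE], a stack-sorted word is uniquely sorted exactly when it has as many
    ascents as descents, which for a V fixes the sizes of the two parts. Being stack-sorted then
    amounts to [dominates a b], since the first and last entries can be peeled off together
    ([vshape_stack_sorted], [vshape_dominates]). Jointly these conditions say that the step word is
    a Dyck path ([dyck_word_Dyck]). On words, [swl] is a chain of stable partitions ([word_swl_at])
    that turns the V into a layered involution with block starts [b] ([slides_vshape]). Its ascents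
    sit right before the block starts, and rotating an involution only reverses its word, so both
    components of [DL] are [dyck_word k b] ([DL_lay]). The image is uniquely sorted and avoids 312
    by [layered_stack_sorted] and [layered_avoids]. Dyck paths are counted through ballot numbers
    ([card_excursion]). *)

Notation ups := (count id).
Notation downs := (count negb).

Fixpoint ballot (h : nat) (t : seq bool) : bool :=
  if t is b :: t' then
    if b then ballot h.+1 t' else (0 < h) && ballot h.-1 t'
  else true.

Definition balanced (t : seq bool) : bool :=
  ups t == downs t.

Lemma ballot_cat h t1 t2 :
  ballot h (t1 ++ t2) =
    ballot h t1 && ballot (h + ups t1 - downs t1) t2.
Proof.
elim: t1 h => [|[] t1 IH] h /=; first by rewrite addn0 subn0.
  by rewrite IH /= add0n addSn addnS.
by case: h => //= h; rewrite IH /= add1n add0n.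
Qed.

Lemma ballot_count h t :
  ballot h t -> downs t <= h + ups t.
Proof.
elim: t h => [|[] t IH] h //=; first by move/IH; lia.
by case/andP=> h0 /IH; lia.
Qed.

Lemma ballot_leq h h' t : h <= h' -> ballot h t -> ballot h' t.
Proof.
elim: t h h' => [|[] t IH] //= h h' hh'; first by apply: IH.
by case/andP=> h0 /IH; rewrite (leq_trans h0 hh'); apply; lia.
Qed.

Lemma ballotP h t :
  reflect (forall m, downs (take m t) <= h + ups (take m t))
          (ballot h t).
Proof.
apply: (iffP idP) => [bt m | ].
  apply: ballot_count; move: bt.
  by rewrite -{1}(cat_take_drop m t) ballot_cat => /andP[].
elim: t h => [|[] t IH] //= h H.
  by apply: IH => m; have := H m.+1; rewrite /=; lia.
apply/andP; split; first by have := H 1; rewrite /= take0 /=; lia.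
by apply: IH => m; have := H m.+1; have := H 1; rewrite /= take0 /=; lia.
Qed.

Lemma first_passage h t : h + ups t < downs t ->
  exists t1 t2, [/\ t = t1 ++ Down :: t2, ballot h t1
                  & downs t1 = h + ups t1].
Proof.
elim: t h => [|[] t IH] h //=.
  move=> H; have [|t1 [t2 [-> b e]]] := IH h.+1; first by lia.
  by exists (true :: t1), t2; split => //=; lia.
case: h => [|h] H; first by exists [::], t.
have [|t1 [t2 [-> b e]]] := IH h; first by lia.
by exists (false :: t1), t2; split => //=; lia.
Qed.

(** The first step to height -1 depends on the path alone, so two such factorizations cut at the
    same place. *)
Lemma first_passage_uniq h t1 t2 u1 u2 :
    t1 ++ Down :: t2 = u1 ++ Down :: u2 ->
    ballot h t1 -> downs t1 = h + ups t1 ->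
    ballot h u1 -> downs u1 = h + ups u1 ->
  t1 = u1.
Proof.
elim: t1 u1 h => [|b t1 IH] [|c u1] h //=.
- by case=> <- _ _; case: h.
- by case=> -> _ + + _; case: h.
case=> <- e; case: b => /= b1 e1 b2 e2; congr (_ :: _).
  by apply: (IH _ h.+1) => //; lia.
by case: h b1 b2 e1 e2 => //= h b1 b2 e1 e2; apply: (IH _ h) => //; lia.
Qed.

(* The steps are read from right to left, as in the first word of [DL].        *)
Definition updown (w : seq nat) : seq bool := rev (behead (pairmap ltn 0 w)).

Lemma size_updown w : size (updown w) = (size w).-1.
Proof. by rewrite size_rev size_behead size_pairmap. Qed.

Lemma nth_updown w i : i.+1 < size w ->
  nth Down (updown w) i =
    (nth 0 w (size w - i.+2) < nth 0 w (size w - i.+1)).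
Proof.
move=> iw; rewrite nth_rev ?size_behead ?size_pairmap; last by lia.
rewrite nth_behead (nth_pairmap 0); last by lia.
rewrite (_ : ((size w).-1 - i.+1).+1 = (size w - i.+2).+1); last by lia.
rewrite [nth 0 (0 :: w) _]/=; congr (_ < nth 0 w _); lia.
Qed.

Lemma updown_cat u w : 0 < size u -> 0 < size w ->
  updown (u ++ w) = updown w ++ (last 0 u < head 0 w) :: updown u.
Proof.
case: u w => // a u [] // b w _ _.
by rewrite /updown /= pairmap_cat /= rev_cat rev_cons cat_rcons.
Qed.

Lemma updown_rcons w n : 0 < size w -> all (fun x => x < n) w ->
  updown (rcons w n) = Up :: updown w.
Proof.
case: w => // a w _ wn; rewrite -cats1 updown_cat //=.
by rewrite (allP wn) // mem_last.
Qed.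

Lemma size_stack_sort w : size (stack_sort w) = size w.
Proof. exact/perm_size/perm_stack_sort. Qed.

Lemma mem_stack_sort w : stack_sort w =i w.
Proof. exact/perm_mem/perm_stack_sort. Qed.

Lemma all_stack_sort a w : all a (stack_sort w) = all a w.
Proof. exact/perm_all/perm_stack_sort. Qed.

Lemma stack_sort_eq0 w : (stack_sort w == [::]) = (w == [::]).
Proof. by rewrite -!size_eq0 size_stack_sort. Qed.

Lemma stack_sort_uniq w : uniq (stack_sort w) = uniq w.
Proof. exact/perm_uniq/perm_stack_sort. Qed.

Lemma max_split (v : seq nat) : 0 < size v -> uniq v ->
  exists (l : seq nat) (n : nat) (r : seq nat),
  [/\ v = l ++ n :: r, all (fun x => x < n) l & all (fun x => x < n) r].
Proof.
move=> v0; have [_ e _ _] := stack_sort_recS 0 v0.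
set l := take _ _ in e; set r := drop _ _ in e; move: e.
have mx x : x \in v -> x <= max_entry v by move=> xv; apply: leq_bigmax_seq.
move=> e uv; exists l, (max_entry v), r; move: uv mx; split => //.
  apply/allP => x xl; rewrite ltn_neqAle mx; last by rewrite e mem_cat xl.
  by rewrite andbT; apply: contraTneq uv => xe; rewrite e cat_uniq /= -xe /= xl andbF.
apply/allP => x xl; rewrite ltn_neqAle mx; last by rewrite e mem_cat inE xl !orbT.
by rewrite andbT; apply: contraTneq uv => xe; rewrite e cat_uniq /= -xe /= xl !andbF.
Qed.

Lemma stack_sort_ind (P : seq nat -> Prop) :
    P [::] ->
    (forall (l : seq nat) (n : nat) (r : seq nat),
       all (fun x => x < n) l -> all (fun x => x < n) r ->
       uniq (l ++ n :: r) -> uniq l -> uniq r -> P l -> P r ->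
       P (l ++ n :: r)) ->
  forall v : seq nat, uniq v -> P v.
Proof.
move=> P0 PS v; have [c] := ubnP (size v); elim: c v => // c IH v vc uv.
have [v0|v0] := posnP (size v); first by rewrite (size0nil v0).
have [l [n [r [ev ln rn]]]] := max_split v0 uv.
rewrite {}ev in vc uv *; move: (uv) vc.
rewrite cat_uniq size_cat /= => /and4P[ul _ _ ur] vc.
by apply: PS => //; apply: IH => //; lia.
Qed.

Lemma last_stack_sort (v : seq nat) x : uniq v -> x \in v -> x <= last 0 (stack_sort v).
Proof.
move=> uv; elim/stack_sort_ind: v / uv => // l n r ln rn _ _ _ _ _.
rewrite stack_sort_cat // catA cats1 last_rcons mem_cat inE.
by case/or3P => [/(allP ln)/ltnW | /eqP -> | /(allP rn)/ltnW].
Qed.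

Lemma updown_stack_sort_cat (l r : seq nat) n :
    all (fun x => x < n) l -> all (fun x => x < n) r ->
    0 < size l -> 0 < size r ->
  updown (stack_sort (l ++ n :: r)) =
    Up :: updown (stack_sort r) ++
      (last 0 (stack_sort l) < head 0 (stack_sort r)) :: updown (stack_sort l).
Proof.
move=> ln rn l0 r0; rewrite stack_sort_cat // catA cats1 updown_rcons.
- by rewrite updown_cat ?size_stack_sort.
- by rewrite size_cat !size_stack_sort; lia.
by rewrite all_cat !all_stack_sort ln.
Qed.

Lemma updown_stack_sort_end (l : seq nat) n :
    all (fun x => x < n) l -> 0 < size l ->
  updown (stack_sort (rcons l n)) = Up :: updown (stack_sort l) /\
  updown (stack_sort (n :: l)) = Up :: updown (stack_sort l).
Proof.
move=> ln l0; rewrite -cats1 -[n :: l]cat0s !stack_sort_cat //=.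
by rewrite cats1 updown_rcons ?all_stack_sort ?size_stack_sort.
Qed.

(** The leading U leaves height at least 1 after the path of [stack_sort r], so even a descent at
    the junction keeps the path nonnegative. *)
Lemma ballot_stack_sort (v : seq nat) : uniq v -> ballot 0 (updown (stack_sort v)).
Proof.
move=> uv; elim/stack_sort_ind: v / uv => // l n r ln rn _ _ _ bl br.
have [l0|l0] := posnP (size l); have [r0|r0] := posnP (size r).
- by rewrite (size0nil l0) (size0nil r0).
- have [_] := updown_stack_sort_end rn r0.
  by rewrite (size0nil l0) /= => -> /=; apply: ballot_leq br.
- have [+ _] := updown_stack_sort_end ln l0.
  by rewrite (size0nil r0) cats1 => -> /=; apply: ballot_leq bl.
rewrite updown_stack_sort_cat //= ballot_cat (ballot_leq _ br) //=.
have := ballot_count br; set d := (1 + _ - _) => h.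
have d0 : 0 < d by rewrite /d; lia.
by case: ifP => _; rewrite ?d0; apply: ballot_leq bl.
Qed.

(** Ups exceed downs by 1 from the leading U, by 1 or -1 from the junction, and by a nonnegative
    amount from each part ([ballot_stack_sort]). The sum vanishes only if the junction is a descent
    and both parts are balanced; an empty part would leave at least 1. *)
Lemma balanced_stack_sort_cat (l r : seq nat) n :
    all (fun x => x < n) l -> all (fun x => x < n) r ->
    uniq l -> uniq r -> 0 < size l + size r ->
    balanced (updown (stack_sort (l ++ n :: r))) ->
  [/\ 0 < size l, 0 < size r,
      head 0 (stack_sort r) <= last 0 (stack_sort l),
      balanced (updown (stack_sort l)) & balanced (updown (stack_sort r))].
Proof.
move=> ln rn ul ur lr0.
have := ballot_count (ballot_stack_sort ul).
have := ballot_count (ballot_stack_sort ur).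
rewrite /balanced.
have [l0|l0] := posnP (size l).
  have r0 : 0 < size r by lia.
  have [_] := updown_stack_sort_end rn r0.
  by rewrite (size0nil l0) /= => -> /=; lia.
have [r0|r0] := posnP (size r).
  have [+ _] := updown_stack_sort_end ln l0.
  by rewrite (size0nil r0) cats1 => -> /=; lia.
rewrite updown_stack_sort_cat //= !count_cat /=.
by case: ltnP => _ /=; rewrite ?add0n ?add1n => *; split => //; lia.
Qed.

(** In the path U P D Q the first return to 0 ends P and so gives the length of [r]. The sorted word
    then splits in one way only, and induction applies to both parts. *)
Lemma stack_sort_balanced_inj (v v' : seq nat) : uniq v ->
  balanced (updown (stack_sort v)) -> stack_sort v = stack_sort v' -> v = v'.
Proof.
move=> uv; elim/stack_sort_ind: v / uv v' => [|l n r ln rn un ul ur IHl IHr] v' bv e.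
  by apply/esym/eqP; rewrite -stack_sort_eq0 -e.
have : uniq v' by rewrite -stack_sort_uniq -e stack_sort_uniq.
have v'0 : 0 < size v'.
  by rewrite -size_stack_sort -e size_stack_sort size_cat addnS.
move/(max_split v'0) => [l' [n' [r' [ev' ln' rn']]]].
have : uniq v' by rewrite -stack_sort_uniq -e stack_sort_uniq.
rewrite {}ev' {v' v'0} in e *; rewrite cat_uniq /= => /and4P[ul' _ _ ur'].
have bv' := bv; rewrite e in bv'; have eu := congr1 updown e.
move: e; rewrite !stack_sort_cat // !(catA, cats1) => /rcons_inj[es en].
have sz := congr1 size es; rewrite !size_cat !size_stack_sort in sz.
subst n'; have [lr0|lr0] := posnP (size l + size r).
  suff: [/\ size l = 0, size r = 0, size l' = 0 & size r' = 0].
    by case=> /size0nil -> /size0nil -> /size0nil -> /size0nil ->.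
  by split; lia.
have [l0 r0 hd bl br] := balanced_stack_sort_cat ln rn ul ur lr0 bv.
rewrite sz in lr0.
have [l0' r0' hd' bl' br'] := balanced_stack_sort_cat ln' rn' ul' ur' lr0 bv'.
move: eu; rewrite !updown_stack_sort_cat // !ltnNge hd hd' /= => -[eu].
have := first_passage_uniq eu (ballot_stack_sort ur) _ (ballot_stack_sort ur').
rewrite /= !add0n (eqP br) (eqP br') => /(_ erefl erefl) /(congr1 size).
rewrite !size_updown !size_stack_sort => szr.
have szl : size l = size l' by move: r0 r0' sz szr; clear; lia.
move/eqP: es; rewrite eqseq_cat ?size_stack_sort // => /andP[/eqP el /eqP er].
by rewrite (IHl l' bl el) (IHr r' br er).
Qed.

(** The witness built by the induction is [l ++ r]. Following left parts down [r] ends at a subword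
    [m :: r2]; there [m] also exceeds [l], so [l] becomes the left part at [m]. *)
Lemma stack_sort_merge (l r : seq nat) : uniq r -> 0 < size r ->
    all (fun x => x < head 0 (stack_sort r)) l ->
  exists t, stack_sort t = stack_sort l ++ stack_sort r.
Proof.
move=> ur; elim/stack_sort_ind: r / ur => // r1 m r2 r1m r2m _ _ ur2 IH _ _.
rewrite stack_sort_cat //; have [r10|r10] := posnP (size r1).
  rewrite (size0nil r10) /= => lh; exists (l ++ m :: r2).
  rewrite stack_sort_cat //; apply: sub_all lh => x /leq_trans; apply.
  case e : (stack_sort r2) => [|y s] //=; apply: ltnW.
  by apply: (allP r2m); rewrite -mem_stack_sort e mem_head.
have -> : head 0 (stack_sort r1 ++ stack_sort r2 ++ [:: m])
            = head 0 (stack_sort r1).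
  by move: r10; rewrite -size_stack_sort; case: (stack_sort r1).
move=> lh; have [t et] := IH r10 lh.
exists (t ++ m :: r2); rewrite stack_sort_cat ?et ?catA //.
rewrite -all_stack_sort et all_cat !all_stack_sort r1m andbT.
apply: sub_all lh => x /ltn_trans; apply.
apply: (allP r1m); rewrite -mem_stack_sort.
by move: r10; rewrite -size_stack_sort; case: (stack_sort r1) => //= y s; rewrite mem_head.
Qed.

(** If exactly one part is empty, moving [n] to the other end gives a second preimage. If the
    junction is an ascent, [stack_sort_merge] gives one that ends with [n]. Otherwise the junction
    is a descent and both parts inherit uniqueness. *)
Lemma balanced_unique_preimage (v : seq nat) : uniq v ->
  (forall v', stack_sort v' = stack_sort v -> v' = v) ->
  balanced (updown (stack_sort v)).
Proof.
move=> uv; elim/stack_sort_ind: v / uv => // l n r ln rn uv ul ur IHl IHr.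
have [l0|l0] := posnP (size l); have [r0|r0] := posnP (size r) => uq.
- by rewrite (size0nil l0) (size0nil r0).
- have := uq (rcons r n); rewrite (size0nil l0) -cats1 !stack_sort_cat //=.
  move=> /(_ erefl); case: (r) rn r0 => //= x s /andP[xn _] _ [xe _].
  by rewrite xe ltnn in xn.
- have := uq (n :: l); rewrite (size0nil r0) -[n :: l]cat0s !stack_sort_cat //=.
  move=> /(_ erefl); case: (l) ln l0 => //= x s /andP[xn _] _ [xe _].
  by rewrite xe ltnn in xn.
have bl : balanced (updown (stack_sort l)).
  apply: IHl => l' e; have := uq (l' ++ n :: r).
  have ln' : all (fun x => x < n) l' by rewrite -all_stack_sort e all_stack_sort.
  rewrite !stack_sort_cat // e => /(_ erefl) /eqP.
  by rewrite eqseq_cat ?eqxx ?andbT -?(size_stack_sort l') ?e ?size_stack_sort // => /eqP.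
have br : balanced (updown (stack_sort r)).
  apply: IHr => r' e; have := uq (l ++ n :: r').
  have rn' : all (fun x => x < n) r' by rewrite -all_stack_sort e all_stack_sort.
  rewrite !stack_sort_cat // e => /(_ erefl) /eqP.
  by rewrite eqseq_cat // eqxx eqseq_cons eqxx /= => /eqP.
rewrite updown_stack_sort_cat // /balanced /= !count_cat /=.
rewrite (eqP bl) (eqP br); case: ltnP => [lt|_] /=; last first.
  by apply/eqP; clear; lia.
have lh : all (fun x => x < head 0 (stack_sort r)) l.
  by apply/allP => x xl; apply: leq_ltn_trans lt; apply: last_stack_sort.
have [t et] := stack_sort_merge ur r0 lh.
have tn : all (fun x => x < n) t.
  by rewrite -all_stack_sort et all_cat !all_stack_sort ln.
have := uq (t ++ [:: n]); rewrite !stack_sort_cat // et -!catA => /(_ erefl) e.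
have := congr1 (last 0) e; rewrite !last_cat.
case: (r) r0 rn => [|x s] // _ /allP/(_ (last x s) (mem_last x s)) + /= en.
by rewrite -en ltnn.
Qed.

Lemma uniquely_sortedE (v : seq nat) : uniq v ->
  uniquely_sorted (stack_sort v) = balanced (updown (stack_sort v)).
Proof.
move=> uv; apply/uniquely_sortedP/idP => [[u [eu uu]]|b].
  apply: balanced_unique_preimage => // v' ev'.
  by rewrite -(uu v) // -(uu v').
exists v; split=> // v' ev'; apply: stack_sort_balanced_inj => //.
Qed.

(** * Layered words and V-shaped words *)

(* Every maximal run of descents is followed only by larger entries.           *)
Definition layered (w : seq nat) : Prop :=
  forall i m j, i <= m < j -> j < size w ->
    nth 0 w m < nth 0 w m.+1 -> nth 0 w i < nth 0 w j.

Lemma layered_cat (u w : seq nat) : layered (u ++ w) -> layered u /\ layered w.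
Proof.
move=> L; split=> i m j imj js.
  have := L i m j imj; rewrite size_cat !nth_cat.
  by rewrite !(fun x (h : x <= j) => leq_ltn_trans h js) //; try (apply; lia); lia.
have := L (size u + i) (size u + m) (size u + j).
by rewrite size_cat -addnS !nth_cat !ltnNge !leq_addr /= !addKn; apply; lia.
Qed.

Lemma layered_max (w : seq nat) n : layered (rcons w n) -> last 0 w < n ->
  all (fun x => x < n) w.
Proof.
move=> L ln; apply/(all_nthP 0) => i iw.
have := L i (size w).-1 (size w).
rewrite size_rcons prednK ?(leq_ltn_trans _ iw) //.
rewrite !nth_rcons iw ltnn eqxx ltn_predL (leq_ltn_trans _ iw) //.
by rewrite nth_last; apply => //; lia.
Qed.

Lemma stack_sort1 n : stack_sort [:: n] = [:: n].
Proof. exact: (@stack_sort_cat [::] [::] n). Qed.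

(** The steps form a path U P D Q, and cutting at D gives layered factors with Dyck paths Q and P,
    stack-sorted by induction. By [layered_max] the last entry [n] is the maximum, so it can be
    inserted between the two preimages. *)
Lemma layered_stack_sorted (w : seq nat) : 0 < size w -> layered w ->
  ballot 0 (updown w) -> balanced (updown w) -> exists v, stack_sort v = w.
Proof.
have [c] := ubnP (size w); elim: c w => // c IH w.
case/lastP: w => // u n; rewrite size_rcons => uc _ L.
have [u0|u0] := posnP (size u).
  by rewrite (size0nil u0) => _ _; exists [:: n]; rewrite stack_sort1.
rewrite -{1 2}cats1 updown_cat //= /balanced.
case: ltnP => //= un bu eu.
have [|t1 [t2 [et b1 e1]]] := @first_passage 0 (updown u); first by lia.
move: bu eu; rewrite et ballot_cat !count_cat /= => /andP[_ /andP[_ b2]] e2.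
have sz := congr1 size et; rewrite size_updown size_cat /= in sz.
(* Steps are read from the right, so [t1] belongs to the last [(size t1).+1] entries of [u]. *)
set j := size u - (size t1).+1.
have sA : size (take j u) = (size t2).+1 by rewrite size_takel /j; lia.
have sB : size (drop j u) = (size t1).+1 by rewrite size_drop /j; lia.
have := et; rewrite -{1}(cat_take_drop j u) updown_cat ?sA ?sB //.
move/eqP; rewrite eqseq_cat ?size_updown ?sB // eqseq_cons.
case/and3P => /eqP eB _ /eqP eA.
have [LA LB] : layered (take j u) /\ layered (drop j u).
  apply: layered_cat; rewrite cat_take_drop.
  by move: L; rewrite -cats1 => /layered_cat[].
have [vA eqA] : exists v, stack_sort v = take j u.
  apply: IH; rewrite ?sA ?eA /balanced //; try lia.
  by apply: ballot_leq b2; lia.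
have [vB eqB] : exists v, stack_sort v = drop j u.
  by apply: IH; rewrite ?sB ?eB /balanced //; lia.
have := layered_max L un; rewrite -{1}(cat_take_drop j u) all_cat.
rewrite -eqA -eqB !all_stack_sort => /andP[An Bn].
exists (vA ++ n :: vB); rewrite stack_sort_cat // eqA eqB catA cats1.
by rewrite cat_take_drop.
Qed.

(** * Stack-sorted V-shaped words *)

Definition vshape (a b : seq nat) : Prop :=
  [/\ pairwise gtn a, pairwise ltn b, 0 < size b, all (fun x => head 0 b < x) a
    & uniq (a ++ b)].

(** The ballot condition when values are read from the largest down, U for [b] and D for [a]. *)
Definition dominates (a b : seq nat) : Prop :=
  forall v, count (leq v) a <= count (leq v) b.

Lemma updown_increasing b :
  pairwise ltn b -> updown b = nseq (size b).-1 Up.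
Proof.
elim/last_ind: b => // b x IH; rewrite pairwise_rcons => /andP[bx pb].
rewrite size_rcons /=; have [b0|b0] := posnP (size b).
  by rewrite (size0nil b0).
by rewrite updown_rcons // IH //; case: (size b) b0.
Qed.

Lemma updown_decreasing a :
  pairwise gtn a -> updown a = nseq (size a).-1 Down.
Proof.
elim/last_ind: a => // a x IH; rewrite pairwise_rcons => /andP[ax pa].
rewrite size_rcons /=; have [a0|a0] := posnP (size a).
  by rewrite (size0nil a0).
rewrite -cats1 updown_cat // IH //=.
case: a ax a0 {pa IH} => // y a /allP/(_ (last y a) (mem_last y a)) /= ax _.
by rewrite ltnNge ltnW.
Qed.

Lemma vshape_balanced a b : vshape a b ->
  balanced (updown (a ++ b)) = (size b == (size a).+1).
Proof.
case=> pa pb b0 ab uab; have [a0|a0] := posnP (size a).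
  rewrite (size0nil a0) /= updown_increasing // /balanced !count_nseq /=.
  by case: (size b) b0 => // m _; rewrite mul1n mul0n.
rewrite updown_cat // updown_increasing // updown_decreasing //.
have -> : (last 0 a < head 0 b) = false.
  case: a a0 ab {pa uab} => // x a _ /allP/(_ _ (mem_last x a)) /=.
  by move/ltnW; rewrite leqNgt => /negbTE.
by rewrite /balanced !count_cat /= !count_nseq /=; apply/eqP/eqP; lia.
Qed.

Lemma vshape_rcons x a b y : 0 < size b -> vshape (x :: a) (rcons b y) ->
  [/\ vshape a b, all (fun z => z < x) a, all (fun z => z < y) b, x \notin a ++ b
    & x != y].
Proof.
move=> b0 []; rewrite /= pairwise_rcons mem_cat mem_rcons inE.
have -> : head 0 (rcons b y) = head 0 b by case: b b0.
move=> /andP[ax pa] /andP[bly pb] _ /andP[_ ab] /andP[].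
rewrite !negb_or -rcons_cat rcons_uniq => /and3P[xa xy xb] /andP[_ uab].
by split=> //; rewrite mem_cat negb_or xa.
Qed.

(** Dominance at [x] makes the last entry [y] the maximum. If [v] sorts to the inner word, then
    [x :: y :: v] sorts to [x], the inner word, [y]. *)
Lemma vshape_stack_sorted a b : vshape a b -> size b = (size a).+1 ->
  dominates a b -> exists v, stack_sort v = a ++ b.
Proof.
elim: a b => [|x a IH] b.
  by case: b => // y [] // _ _ _; exists [:: y]; rewrite stack_sort1.
case/lastP: b => // b y V; rewrite size_rcons => -[sb] D.
have b0 : 0 < size b by rewrite sb.
have [Vab ax bly xab xy] := vshape_rcons b0 V.
have ltxy : x < y.
  have /hasP[z] : has (leq x) (rcons b y).
    by rewrite has_count; apply: leq_trans (D x); rewrite /= leqnn.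
  rewrite mem_rcons inE => /orP[/eqP -> | zb xz]; first by rewrite ltn_neqAle xy.
  by apply: leq_ltn_trans xz _; apply: (allP bly).
have [|v ev] := IH b Vab sb.
  move=> z; have := D z; rewrite -cats1 count_cat /= addn0.
  case: (leqP z x) => [zx|xz _]; first by rewrite (leq_trans zx (ltnW ltxy)); lia.
  rewrite (@eq_in_count _ _ pred0) ?count_pred0 // => u /(allP ax) ux.
  by rewrite /= leqNgt (ltn_trans ux xz).
exists (x :: y :: v); rewrite -[x :: _]/([:: x] ++ y :: v) stack_sort_cat.
- by rewrite stack_sort1 ev -catA cats1.
- by rewrite /= ltxy.
rewrite -all_stack_sort ev all_cat bly andbT.
by apply: sub_all ax => z /ltn_trans; apply.
Qed.

(** The left part of the preimage must sort to [x] alone. Otherwise its sorted form ends with its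
    largest entry [z], which is at least [x] and hence in [b]; but the junction after [z] is not an
    ascent, while [b] increases. So the right part sorts to the inner word, and [x < y] because [y]
    is the maximum. *)
Lemma vshape_dominates a b v : vshape a b -> size b = (size a).+1 ->
  stack_sort v = a ++ b -> dominates a b.
Proof.
elim: a b v => [|x a IH] b v; first by move=> _ _ _ z.
case/lastP: b => // b y V; rewrite size_rcons => -[sb] ev.
have b0 : 0 < size b by rewrite sb.
have uv : uniq v by rewrite -stack_sort_uniq ev; case: V.
have v0 : 0 < size v by rewrite -size_stack_sort ev.
have bal : balanced (updown (stack_sort v)).
  by rewrite ev vshape_balanced // size_rcons sb.
have [Vab ax bly xab xy] := vshape_rcons b0 V.
have [l [n [r [e ln rn]]]] := max_split v0 uv.
rewrite {}e {v v0} in ev uv bal.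
have /and4P[ul _ _ ur] : [&& uniq l, ~~ has (mem l) (n :: r), n \notin r & uniq r].
  by rewrite cat_uniq in uv.
have sz : size l + size r = size (a ++ b) + 1.
  have := congr1 size ev; rewrite size_stack_sort !size_cat /= size_rcons; lia.
have lr0 : 0 < size l + size r by rewrite sz addn1.
have [l0 r0 hd _ _] := balanced_stack_sort_cat ln rn ul ur lr0 bal.
have lmax z : z \in stack_sort l -> z <= last 0 (stack_sort l).
  by rewrite mem_stack_sort; apply: last_stack_sort.
move: ev; rewrite stack_sort_cat // catA cats1 -rcons_cat => /rcons_inj[e en].
rewrite -[size l]size_stack_sort in l0; rewrite -[size r]size_stack_sort in r0.
have xl : x \in stack_sort l.
  by case: (stack_sort l) e l0 => //= z s [-> _] _; rewrite mem_head.
have ltxy : x < y by rewrite -en; apply: (allP ln); rewrite -mem_stack_sort.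
have [u eu] : exists u, stack_sort u = a ++ b.
  case: (stack_sort l) (stack_sort_uniq l) e hd lmax l0 {xl} => // x' l2 _ [->].
  case/lastP: l2 => [e _ _ _|l2 z]; first by exists r.
  case: (stack_sort r) r0 => //= y1 r2 _; rewrite cat_rcons last_rcons => e yz lmax _.
  have zx : x <= z by apply: lmax; rewrite mem_head.
  case: (ltnP (size l2) (size a)) => [l2a|al2].
    have /(allP ax) : z \in a.
      have := congr1 (fun s => nth 0 s (size l2)) e.
      by rewrite /= !nth_cat ltnn subnn l2a /= => ->; apply: mem_nth.
    by rewrite ltnNge zx.
  have eb : drop (size a) (l2 ++ z :: y1 :: r2) = b by rewrite e drop_size_cat.
  rewrite drop_cat in eb.
  have {eb} [d eb] : exists d, b = d ++ z :: y1 :: r2.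
    case: ltnP eb => [_ <-|h <-]; first by eexists.
    by exists [::]; rewrite (eqP (_ : size a - size l2 == 0)) ?drop0.
  case: Vab => _ + _ _ _; rewrite eb pairwise_cat /= => /and3P[_ _ /andP[/andP[+ _] _]].
  by rewrite ltnNge yz.
have D := IH b u Vab sb eu; move=> z; have := D z.
rewrite -cats1 count_cat /= addn0.
case: (leqP z x) => [zx|xz _]; first by rewrite (leq_trans zx (ltnW ltxy)); lia.
rewrite (@eq_in_count _ _ pred0) ?count_pred0 // => w /(allP ax) wx.
by rewrite /= leqNgt (ltn_trans wx xz).
Qed.

(** * The operator swl on words *)

Definition sift (x : nat) (w : seq nat) : seq nat :=
  [seq y <- w | y < x] ++ [seq y <- w | x <= y].

Definition slide (i : nat) (w : seq nat) : seq nat :=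
  sift (nth 0 w i) (take i w) ++ drop i w.

Definition slides (w : seq nat) : seq nat := foldr slide w (iota 0 (size w)).

Lemma nth_filter_count (P : pred nat) (s : seq nat) v : v < size s ->
  P (nth 0 s v) ->
  nth 0 [seq x <- s | P x] (count P (take v s)) = nth 0 s v.
Proof.
elim: s v => // x s IH [|v] /= vs; first by move=> ->.
by move=> /IH <- //; case: ifP.
Qed.

Lemma count_take_lt (P : pred nat) (s : seq nat) v i : v < i -> i <= size s ->
  P (nth 0 s v) -> count P (take v s) < count P (take i s).
Proof.
move=> vi is_ pv.
have := count_cat P (take v.+1 s) (drop v.+1 (take i s)).
rewrite -{1}(take_takel s vi) cat_take_drop => ->.
by rewrite (take_nth 0) -?cats1 ?count_cat /= ?pv; [lia | exact: leq_trans vi is_].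
Qed.

Lemma size_sift x w : size (sift x w) = size w.
Proof.
rewrite size_cat !size_filter -(count_predC (fun y => y < x) w); congr (_ + _).
by apply: eq_count => y; rewrite /= leqNgt.
Qed.

Lemma size_slide i w : size (slide i w) = size w.
Proof. by rewrite size_cat size_sift -size_cat cat_take_drop. Qed.

Lemma nth_word n (p : 'S_n) (j : 'I_n) : nth 0 (word p) j = (p j).+1.
Proof. by rewrite /word (nth_map j) ?size_enum_ord // nth_ord_enum. Qed.

Lemma card_ord_count n (Q : pred nat) :
  #|[set x : 'I_n | Q x]| = count Q (iota 0 n).
Proof. by rewrite cardsE cardE size_filter -enumT -val_enum_ord count_map. Qed.

Lemma card_word_count n (p : 'S_n) (P : pred nat) m : m <= n ->
  #|[set x : 'I_n | (x < m) && P (p x).+1]| = count P (take m (word p)).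
Proof.
move=> mn.
have -> : [set x : 'I_n | (x < m) && P (p x).+1]
            = [set x : 'I_n | (x < m) && P (nth 0 (word p) x)].
  by apply/setP => x; rewrite !inE nth_word.
rewrite (card_ord_count n (fun x => (x < m) && P (nth 0 (word p) x))).
rewrite -(map_nth_iota0 0) ?size_word // count_map.
have -> : iota 0 n = iota 0 m ++ iota m (n - m) by rewrite -iotaD subnKC.
rewrite count_cat [X in _ + X](@eq_in_count _ _ pred0) ?count_pred0 ?addn0.
  by apply: eq_in_count => x; rewrite mem_iota /= => ->.
by move=> x; rewrite mem_iota => /andP[mx _]; rewrite ltnNge mx.
Qed.

Lemma rev_permE n (x : 'I_n) : rev_perm n x = rev_ord x.
Proof. by rewrite permE. Qed.

Lemma perm_rotV n (p : 'S_n) x : ((Defs.perm_rot p)^-1)%g x = rev_ord (p x).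
Proof.
have e : Defs.perm_rot p (rev_ord (p x)) = x by rewrite permM rev_permE rev_ordK permK.
by rewrite -{1}e permK.
Qed.

(** Values of the rotated permutation [q] are positions of [p], and lying further right in [q] means
    having a smaller entry in [p] ([perm_rotV]). So the right set of [i] in [q] consists of the
    positions before [i] with entries below the one at [i]; numbering these first is the stable
    partition. *)
Lemma word_swl_at n (i : 'I_n) (p : 'S_n) :
  word (swl_at i p) = slide i (word p).
Proof.
apply: (@eq_from_nth _ 0) => [|j0]; rewrite ?size_slide !size_word // => jn.
have -> : j0 = Ordinal jn by [].
move: (Ordinal jn) => j {j0 jn}; rewrite nth_word.
(* [v] is the old position of the entry that lands at [j]. *)
set q := Defs.perm_rot p; set v := (p^-1)%g (swl_at i p j).
have -> : (swl_at i p j).+1 = nth 0 (word p) v by rewrite nth_word permKV.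
have ej : j = swu_val i q (rev_ord (swl_at i p j)) :> nat.
  rewrite /swl_at /perm_rot_inv permM rev_permE rev_ordK.
  transitivity (nat_of_ord (swu i q ((swu i q)^-1 j)%g)); first by rewrite permKV.
  by rewrite permE.
have eq : q (rev_ord (swl_at i p j)) = v by rewrite permM rev_permE rev_ordK.
move: ej; rewrite /swu_val eq {eq}.
have R x : (x \in right_smaller i q) = (x < i) && (p x < p i).
  rewrite inE !perm_rotV /=; congr (_ && _).
  by have := ltn_ord (p x); have := ltn_ord (p i); lia.
have iw : i < size (word p) by rewrite size_word.
have ni := nth_word p i; have nv := nth_word p v.
have sz : size (sift (nth 0 (word p) i) (take i (word p))) = i.
  by rewrite size_sift size_takel // ltnW.
have ile : i <= n by apply: ltnW.
case: ifP => [iv -> | /negbT].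
  by rewrite nth_cat sz ltnNge iv /= nth_drop subnKC.
rewrite -ltnNge => vi.
have tv : take v (take i (word p)) = take v (word p) by rewrite take_takel // ltnW.
have nvt : nth 0 (take i (word p)) v = nth 0 (word p) v by rewrite nth_take.
have vt : v < size (take i (word p)) by rewrite size_takel // ltnW.
case: ifP; rewrite R vi /= => pvi.
  have -> : rank_from_bottom (right_smaller i q) v
     = #|[set x : 'I_n | (x < v.+1) && ((p x).+1 < (p i).+1)]|.
    apply: eq_card => x; rewrite [LHS]in_set R [RHS]in_set ltnS.
    by case: (leqP x v) => xv; rewrite ?andbF // andbT (leq_ltn_trans xv vi).
  rewrite (card_word_count p (fun y => y < (p i).+1)) //.
  rewrite (take_nth 0) ?size_word // -cats1 count_cat /= nv ltnS pvi addn1 /=.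
  move=> ->; rewrite /slide nth_cat sz /sift nth_cat ni size_filter.
  have lt : count (fun y => y < (p i).+1) (take v (word p))
              < count (fun y => y < (p i).+1) (take i (word p)).
    by apply: count_take_lt; rewrite ?nv // ltnW.
  rewrite lt (leq_trans lt); last first.
    by apply: leq_trans (count_size _ _) _; rewrite size_takel // ltnW.
  by rewrite -tv nth_filter_count ?nvt ?nv.
have -> : rank_from_top (left_smaller i q) v =
    #|[set x : 'I_n | (x < i) && ((p i).+1 <= (p x).+1)] :\: [set x : 'I_n | x < v]|.
  have vL : v \notin right_smaller i q by rewrite R vi pvi.
  apply: eq_card => x; rewrite [LHS]in_set in_setD !in_set -leqNgt.
  rewrite !perm_rotV andbC /=; congr (_ && _); case: (ltnP x i) => //= xi.
  have /eqP pxi : p x != p i :> nat.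
    by apply: contraTneq xi => /val_inj/perm_inj ->; rewrite ltnn.
  by have := ltn_ord (p x); have := ltn_ord (p i); lia.
rewrite cardsD (card_word_count p (leq (p i).+1) ile).
rewrite (_ : _ :&: _ = [set x : 'I_n | (x < v) && ((p i).+1 <= (p x).+1)]); last first.
  apply/setP => x; rewrite !inE andbC; case: (ltnP x v) => //= xv.
  by rewrite (ltn_trans xv vi).
rewrite (card_word_count p (leq (p i).+1)) ?(ltnW (ltn_ord v)) //.
have pl : (p i).+1 <= nth 0 (word p) v by rewrite nv ltnS leqNgt pvi.
have lt : count (leq (p i).+1) (take v (word p)) < count (leq (p i).+1) (take i (word p)).
  by apply: count_take_lt => //; rewrite ltnW.
have e : count (fun y => y < (p i).+1) (take i (word p))
           + count (leq (p i).+1) (take i (word p)) = i.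
  rewrite -[RHS](size_takel (ltnW iw)) -(count_predC (fun y => y < (p i).+1)).
  by congr (_ + _); apply: eq_count => y; rewrite /= leqNgt.
rewrite /slide nth_cat sz /sift nth_cat ni size_filter => ->.
(* The rank counts the large entries from [v] on; what remains of [i] is all small entries and the
   large ones before [v]. *)
have -> : i - (count (leq (p i).+1) (take i (word p)) - count (leq (p i).+1) (take v (word p)))
   = count (fun y => y < (p i).+1) (take i (word p)) + count (leq (p i).+1) (take v (word p)).
  by move: e lt; clear; lia.
rewrite -{2}e ltn_add2l lt ltnNge leq_addr /= addKn.
by rewrite -tv nth_filter_count ?nvt.
Qed.

Lemma word_swl n (p : 'S_n) : word (swl p) = slides (word p).
Proof.
rewrite /swl /slides size_word -val_enum_ord.
elim: (enum 'I_n) => //= i s IH.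
by rewrite word_swl_at IH.
Qed.

(** The last index acts first and partitions everything before [x]; the slides at smaller indices
    never move the last entry. *)
Lemma slides_rcons w x : slides (rcons w x) = rcons (slides (sift x w)) x.
Proof.
rewrite /slides size_rcons size_sift -addn1 iotaD add0n /= cats1 foldr_rcons.
have -> : slide (size w) (rcons w x) = rcons (sift x w) x.
  by rewrite /slide nth_rcons ltnn eqxx -cats1 take_size_cat // drop_size_cat // cats1.
have : size (sift x w) = size w by rewrite size_sift.
move: (sift x w) => u su.
have : all (fun i => i < size u) (iota 0 (size w)).
  by apply/allP => i; rewrite su mem_iota.
elim: (iota _ _) => //= i s IH /andP[iu /IH ->].
have /= : size (foldr slide u s) = size u.
  by elim: s {IH} => //= i' s IH; rewrite size_slide.
move: (foldr _ _ _) => w' sw'.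
rewrite /slide nth_rcons sw' iu -!cats1 takel_cat ?sw' 1?ltnW //.
by rewrite drop_cat sw' iu catA.
Qed.

(** * The layered involution *)

(* Concatenation of the reversed blocks of [1 .. n] that start at the entries  *)
(* of c, which is listed in decreasing order.                                  *)
Fixpoint lay (n : nat) (c : seq nat) : seq nat :=
  if c is x :: c' then lay x.-1 c' ++ rev (iota x (n.+1 - x)) else [::].

Definition block_starts (n : nat) (c : seq nat) : bool :=
  [&& pairwise gtn c, all (fun x => 0 < x <= n) c & (0 < n) ==> (1 \in c)].

Lemma block_starts_cons n x c : block_starts n (x :: c) ->
  [/\ 0 < x <= n, block_starts x.-1 c & forall y, y \in c -> y < x].
Proof.
rewrite /block_starts /= => /and3P[/andP[/allP xc pc] /andP[xn /allP cn] n1].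
split=> //; rewrite pc /=; apply/andP; split.
  by apply/allP => y yc; have := xc y yc; have /andP[-> _] := cn y yc; rewrite /=; lia.
apply/implyP => x1; have : 0 < n by lia.
by move/(implyP n1); rewrite inE => /orP[/eqP e|//]; lia.
Qed.

Lemma size_lay n c : block_starts n c -> size (lay n c) = n.
Proof.
elim: c n => [|x c IH] n; first by case: n.
case/block_starts_cons => xn bc _.
by rewrite size_cat size_rev size_iota IH //; lia.
Qed.

Lemma nth_lay n x c i : block_starts n (x :: c) -> i < n ->
  nth 0 (lay n (x :: c)) i =
    if i < x.-1 then nth 0 (lay x.-1 c) i else n + x.-1 - i.
Proof.
case/block_starts_cons => xn bc _ iN.
rewrite /= nth_cat size_lay //; case: ltnP => // xi.
rewrite nth_rev ?size_iota; last by lia.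
by rewrite nth_iota; lia.
Qed.

Lemma lay_bounds n c i : block_starts n c -> i < n ->
  0 < nth 0 (lay n c) i <= n.
Proof.
elim: c n i => [|x c IH] n i; first by case: n.
move=> B iN; rewrite nth_lay //; have [xn bc _] := block_starts_cons B.
case: (ltnP i x.-1) => xi; last by lia.
by have := IH _ _ bc xi; lia.
Qed.

(** Within a block, position and value have a constant sum. The shifts by 1 convert between 0-based
    positions and 1-based values. *)
Lemma lay_involutive n c i : block_starts n c -> i < n ->
  nth 0 (lay n c) (nth 0 (lay n c) i).-1 = i.+1.
Proof.
elim: c n i => [|x c IH] n i; first by case: n.
move=> B iN; have [xn bc _] := block_starts_cons B.
have := lay_bounds B iN; rewrite [nth 0 _ i]nth_lay //.
case: (ltnP i x.-1) => xi bd; rewrite nth_lay //; try lia.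
  have b := lay_bounds bc xi; rewrite IH //.
  by have -> : (nth 0 (lay x.-1 c) i).-1 < x.-1 by lia.
by have -> : (n + x.-1 - i).-1 < x.-1 = false; lia.
Qed.

(** The word descends inside blocks and ascends across boundaries. A block occupies the positions
    equal to its values, so an ascent into the 1-based position [i.+2] means that [i.+2] is a block
    start. *)
Lemma lay_ascent n c i : block_starts n c -> i.+1 < n ->
  (nth 0 (lay n c) i < nth 0 (lay n c) i.+1) = (i.+2 \in c).
Proof.
elim: c n i => [|x c IH] n i; first by case: n.
move=> B iN; have [xn bc cx] := block_starts_cons B.
have iN' := ltnW iN; rewrite !(nth_lay B) // inE.
case: (ltnP i.+1 x.-1) => ix.
  have -> : i < x.-1 by exact: ltnW ix.
  by rewrite IH //; case: eqP => //; lia.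
have -> : (i.+2 \in c) = false by apply/negP => /cx; lia.
case: (ltnP i x.-1) => ix'; rewrite orbF; last by apply/idP/eqP; lia.
by have bd := lay_bounds bc ix'; apply/idP/eqP; lia.
Qed.

Lemma lay_layered n c : block_starts n c -> layered (lay n c).
Proof.
elim: c n => [|x c IH] n; first by move=> _ i m j _; rewrite ltn0.
move=> B i m j imj; rewrite size_lay // => jn.
have [xn bc cx] := block_starts_cons B.
rewrite !nth_lay //; try lia.
case: (ltnP j x.-1) => jx.
  have -> : m.+1 < x.-1 by lia.
  have -> : m < x.-1 by lia.
  have -> : i < x.-1 by lia.
  by apply: IH => //; rewrite size_lay.
case: (ltnP i x.-1) => ix; first by have := lay_bounds bc ix; lia.
by case: (ltnP m x.-1); case: (ltnP m.+1 x.-1); lia.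
Qed.

(** * Sliding a V-shaped word into a layered one *)

Lemma slides_cat_decreasing u c : pairwise gtn c ->
    all (fun y => all (fun z => z < y) u) c ->
  slides (u ++ c) = slides u ++ c.
Proof.
elim/last_ind: c => [|c y IH]; first by rewrite !cats0.
rewrite pairwise_rcons all_rcons => /andP[cy pc] /andP[uy uc].
rewrite -!rcons_cat slides_rcons; congr rcons; rewrite -IH //; congr slides.
(* Sifting by [y] changes nothing: [u] lies below [y] and the rest of the decreasing tail above
   it. *)
rewrite /sift !filter_cat.
have /all_filterP -> := uy; rewrite -catA; congr (_ ++ _).
rewrite (@eq_in_filter _ _ pred0) ?filter_pred0 /=; last first.
  by move=> z /(allP cy) /= yz; rewrite ltnNge ltnW.
rewrite (@eq_in_filter _ (leq y) pred0 u) ?filter_pred0 /=; last first.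
  by move=> z /(allP uy) /= zy; rewrite leqNgt zy.
by apply/all_filterP; apply: sub_all cy => z /ltnW.
Qed.

(** Sifting by the largest entry [x] of the increasing part sends the entries above [x], all from
    [a] and already decreasing, to the end. Followed by [x] they form the last reversed block, and
    what precedes is a V on 1, ..., x - 1. *)
Lemma slides_vshape a b n : vshape a b -> perm_eq (a ++ b) (iota 1 n) ->
  slides (a ++ b) = lay n (rev b).
Proof.
elim/last_ind: b a n => [|b x IH] a n; first by case.
move=> V pe; have [pa pb _ hb uab] := V.
move: pb; rewrite pairwise_rcons => /andP[bx pb].
have mem y : (y \in a) || (y == x) || (y \in b) = (0 < y <= n).
  by have := perm_mem pe y; rewrite mem_cat mem_rcons inE mem_iota orbA add1n ltnS.
have xn : 0 < x <= n by rewrite -mem eqxx orbT.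
rewrite -rcons_cat slides_rcons rev_rcons /=.
have -> : sift x (a ++ b) = ([seq y <- a | y < x] ++ b) ++ [seq y <- a | x <= y].
  rewrite /sift !filter_cat; have /all_filterP -> := bx.
  rewrite [X in _ ++ _ ++ X](@eq_in_filter _ _ pred0) ?filter_pred0 ?cats0 //.
  by move=> z /(allP bx) /= zx; rewrite leqNgt zx.
rewrite slides_cat_decreasing; first last.
- apply/allP => y; rewrite mem_filter => /andP[xy ya]; rewrite all_cat.
  rewrite all_filter; apply/andP; split; apply/allP => z.
    by move=> _; apply/implyP => zx; apply: leq_trans xy.
  by move/(allP bx) => zx; apply: leq_trans xy.
- by apply: subseq_pairwise pa; apply: filter_subseq.
rewrite rcons_cat; congr (_ ++ _).
  (* With [b] empty, [x] is the minimum and nothing precedes its block. *)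
  case: (posnP (size b)) => b0.
    rewrite (size0nil b0) /= cats0 (@eq_in_filter _ _ pred0) ?filter_pred0 //.
    move=> z /(allP hb); rewrite (size0nil b0) /= ltnNge => xz.
    by rewrite ltnNge ltnW // ltnNge.
  apply: IH.
    split=> //.
    - by apply: subseq_pairwise pa; apply: filter_subseq.
    - rewrite all_filter; apply: sub_all hb => z; rewrite /=; case: (b) b0 => //= y s _ ->.
      by rewrite implybT.
    - move: uab; rewrite -rcons_cat rcons_uniq => /andP[_].
      by apply: subseq_uniq; apply: cat_subseq => //; apply: filter_subseq.
  apply: uniq_perm; rewrite ?iota_uniq //.
    move: uab; rewrite -rcons_cat rcons_uniq => /andP[_].
    by apply: subseq_uniq; apply: cat_subseq => //; apply: filter_subseq.
  move=> y; rewrite mem_cat mem_filter mem_iota add1n prednK; last by lia.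
  have := mem y; case: (y \in b) (allP bx y) => [/(_ isT)|_].
    by rewrite !orbT => yx /esym/andP[-> _]; rewrite (yx : y < x).
  rewrite !orbF; case: (ltngtP y x) => yx /=; rewrite ?orbF ?andbF //= => ->.
  by lia.
(* Both sides are decreasing lists of the values from [x] to [n]. *)
apply: (@irr_sorted_eq _ gtn).
- by move=> p q r /= h1 h2; apply: ltn_trans h1.
- by move=> p; rewrite /= ltnn.
- rewrite sorted_pairwise; last by move=> p q r /= h1 h2; apply: ltn_trans h1.
  rewrite pairwise_rcons; apply/andP; split; last first.
    by apply: subseq_pairwise pa; apply: filter_subseq.
  apply/allP => y; rewrite mem_filter leq_eqVlt => /andP[/orP[/eqP e|//] ya].
  move: uab; rewrite -rcons_cat rcons_uniq mem_cat negb_or e.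
  by rewrite ya.
- by rewrite rev_sorted; apply: iota_ltn_sorted.
move=> y; rewrite mem_rcons inE mem_filter mem_rev mem_iota.
have := mem y; case: (y \in b) (allP bx y) => [/(_ isT)|_].
  by move=> yx; lia.
by rewrite orbF; case: ltngtP; lia.
Qed.

(** * Pattern avoidance *)

Lemma subseq_nthP (s w : seq nat) : reflect
  (exists2 I, sorted ltn I /\ all (gtn (size w)) I & s = [seq nth 0 w i | i <- I])
  (subseq s w).
Proof.
apply: (iffP idP) => [/subseqP[m _ ->] | [I [sI aI] ->]].
  exists (mask m (iota 0 (size w))); last first.
    by rewrite map_mask map_nth_iota0 // take_size.
  split; first by apply: (sorted_mask ltn_trans); apply: iota_ltn_sorted.
  by apply/allP => i /mem_mask; rewrite mem_iota.
rewrite -{2}[w](take_size) -(map_nth_iota0 0) //; apply: map_subseq.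
have -> : I = [seq i <- iota 0 (size w) | i \in I]; last exact: filter_subseq.
apply: (irr_sorted_eq ltn_trans ltnn) => //.
  by apply: (sorted_filter ltn_trans); apply: iota_ltn_sorted.
move=> i; rewrite mem_filter mem_iota /= add0n.
by case iI: (i \in I) => //=; have /= := allP aI i iI => ->.
Qed.

Lemma avoids3P (w : seq nat) x y z : reflect
  (forall i j l, i < j < l -> l < size w ->
     ~~ same_order [:: nth 0 w i; nth 0 w j; nth 0 w l] [:: x; y; z])
  (avoids w [:: x; y; z]).
Proof.
apply: (iffP (avoidsP _ _)) => [H i j l /andP[ij jl] lw | H u].
  apply: H; apply/subseq_nthP; exists [:: i; j; l] => //=; split.
    by rewrite ij jl.
  by rewrite lw (ltn_trans jl lw) (ltn_trans ij (ltn_trans jl lw)).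
move/subseq_nthP => [I [sI aI] ->]; case: I sI aI => [|i [|j [|l []]]] //=.
by rewrite !andbT => ijl /and3P[_ _ lw]; apply: H.
Qed.

Lemma same_order3 (a b c x y z : nat) :
  same_order [:: a; b; c] [:: x; y; z] =
    [&& (a < b) == (x < y), (b < a) == (y < x), (a < c) == (x < z),
        (c < a) == (z < x), (b < c) == (y < z) & (c < b) == (z < y)].
Proof.
rewrite /same_order /=; apply/forallP/idP => [H | H].
  have o1 : 1 < 3 by []; have o2 : 2 < 3 by [].
  have /forallP H0 := H ord0; have /forallP H1 := H (Ordinal o1).
  have /forallP H2 := H (Ordinal o2).
  rewrite (H0 (Ordinal o1)) (H0 (Ordinal o2)) (H1 ord0) (H2 ord0).
  by rewrite (H1 (Ordinal o2)) (H2 (Ordinal o1)).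
case/and5P: H => h1 h2 h3 h4 /andP[h5 h6].
by case=> [[|[|[|]]] ?] //; apply/forallP; case=> [[|[|[|]]] ?] //=; rewrite !ltnn.
Qed.

Lemma nth_neq (w : seq nat) i j : uniq w -> i < j -> j < size w ->
  nth 0 w i <> nth 0 w j.
Proof.
move=> uw ij jw /eqP; rewrite nth_uniq // ?(ltn_trans ij) //.
by rewrite (ltn_eqF ij).
Qed.

Definition peakless (w : seq nat) : Prop :=
  forall i j l, i < j < l -> l < size w ->
    nth 0 w i < nth 0 w j -> nth 0 w j < nth 0 w l.

(** An entry with smaller entries on both sides is the peak of a 132 or a 231, according to which
    side is lower. *)
Lemma peakless_avoids (w : seq nat) : uniq w ->
  peakless w <-> all (avoids w) [:: [:: 1; 3; 2]; [:: 2; 3; 1]].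
Proof.
move=> uw; rewrite /= andbT; split=> [H | /andP[/avoids3P H1 /avoids3P H2]].
  apply/andP; split; apply/avoids3P => i j l ijl lw; have := H i j l ijl lw.
    by rewrite same_order3; lia.
  by rewrite same_order3; lia.
move=> i j l ijl lw; have := H1 i j l ijl lw; have := H2 i j l ijl lw.
have := @nth_neq w i l uw _ lw; have := @nth_neq w j l uw _ lw.
by rewrite !same_order3; lia.
Qed.

(** If a later entry is below an earlier one, there is no ascent between them, so no entry in
    between is the smallest of the three. *)
Lemma layered_avoids (w : seq nat) : layered w -> avoids w [:: 3; 1; 2].
Proof.
move=> L; apply/avoids3P => i j l ijl lw; rewrite same_order3.
suff : nth 0 w l < nth 0 w i -> nth 0 w l <= nth 0 w j by lia.
move=> li.
have D m : i <= m < l -> nth 0 w m.+1 <= nth 0 w m.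
  by move=> iml; rewrite leqNgt; apply/negP => /(L i m l iml lw); lia.
have H d : d <= l - j -> nth 0 w (j + d) <= nth 0 w j.
  elim: d => [|d IH] dl; first by rewrite addn0.
  apply: leq_trans (IH _); last by lia.
  by rewrite addnS; apply: D; lia.
by have := H (l - j) (leqnn _); rewrite subnKC //; lia.
Qed.

Lemma vshape_peakless a b : vshape a b -> peakless (a ++ b).
Proof.
case=> /(pairwiseP 0) pa /(pairwiseP 0) pb _ _ _ i j l ijl.
rewrite size_cat !nth_cat => lw.
case: (ltnP j (size a)) => ja.
  have -> : i < size a by lia.
  move=> h; have := pa i j _ _ _; rewrite !inE /=; lia.
have -> : l < size a = false by lia.
by move=> _; apply: pb; rewrite ?inE; lia.
Qed.

(** The cut is at the entry 1: an increasing pair before it, or a decreasing pair after it, would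
    make a peak together with 1. *)
Lemma peakless_vshape (w : seq nat) n : 0 < n -> perm_eq w (iota 1 n) -> peakless w ->
  exists a b : seq nat, w = a ++ b /\ vshape a b.
Proof.
move=> n0 pw P; have uw : uniq w by rewrite (perm_uniq pw) iota_uniq.
have w1 : 1 \in w by rewrite (perm_mem pw) mem_iota; lia.
have iw : index 1 w < size w by rewrite index_mem.
have n1 : nth 0 w (index 1 w) = 1 by rewrite nth_index.
have gt1 i : i < size w -> i != index 1 w -> 1 < nth 0 w i.
  move=> iw' ii; have := mem_nth 0 iw'; rewrite (perm_mem pw) mem_iota.
  have /eqP : nth 0 w i != nth 0 w (index 1 w) by rewrite nth_uniq.
  by rewrite n1 => w1' /andP[w0 _]; rewrite ltn_neqAle w0 andbT; apply/eqP/nesym.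
exists (take (index 1 w) w), (drop (index 1 w) w); rewrite cat_take_drop; split=> //.
split; rewrite ?cat_take_drop //.
- apply/(pairwiseP 0) => i j; rewrite !inE size_takel ?(ltnW iw) // => ii ji ij.
  rewrite !nth_take //=.
  have := P i j (index 1 w) _ iw; rewrite ij ji n1 => /(_ isT).
  have := gt1 j; rewrite (ltn_trans ji iw) => /(_ isT).
  have := nth_neq uw ij (ltn_trans ji iw).
  by lia.
- apply/(pairwiseP 0) => i j; rewrite !inE size_drop => ii ji ij.
  rewrite !nth_drop.
  have [->|i0] := posnP i; first by rewrite addn0 n1; apply: gt1; lia.
  by apply: (P (index 1 w)); rewrite ?n1; try lia; apply: gt1; lia.
- by rewrite size_drop subn_gt0.
rewrite -nth0 nth_drop addn0 n1; apply/(all_nthP 0) => i.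
rewrite size_takel ?(ltnW iw) // => ii; rewrite nth_take //; apply: gt1; lia.
Qed.

(** * The number of Dyck paths *)

Lemma mem_Dyck k (t : (2 * k).-tuple bool) :
  (t \in Dyck k) = balanced t && ballot 0 t.
Proof.
have u s : count_mem Up s = ups s by apply: eq_count => -[].
have d s : count_mem Down s = downs s by apply: eq_count => -[].
have sz : ups t + downs t = 2 * k by rewrite -[RHS](size_tuple t) count_predC.
rewrite inE u d /balanced.
have -> : (ups t == downs t) = (ups t == k) && (downs t == k).
  by apply/eqP/andP => [e | [/eqP -> /eqP ->] //]; split; apply/eqP; lia.
rewrite -andbA; do 2!congr (_ && _).
apply/forallP/ballotP => [H m | H m]; last by rewrite u d; apply: H.
have mk : minn m (2 * k) < (2 * k).+1 by rewrite ltnS geq_minr.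
have := H (Ordinal mk); rewrite u d /= /minn.
by case: ltnP => // mk'; rewrite !take_oversize ?size_tuple.
Qed.

Definition excursion (h : nat) (t : seq bool) : bool :=
  ballot h t && (h + ups t == downs t).

Lemma excursion_size h t : excursion h t -> h <= size t.
Proof. by case/andP=> _ /eqP; have := count_size negb t; lia. Qed.

Lemma card_tuple_cons n (P : pred (seq bool)) :
  #|[set t : n.+1.-tuple bool | P t]| =
    #|[set t : n.-tuple bool | P (Up :: t)]| +
    #|[set t : n.-tuple bool | P (Down :: t)]|.
Proof.
have inj b : injective (fun t : n.-tuple bool => [tuple of b :: t]).
  by move=> s t /(congr1 val) [/val_inj].
rewrite -(card_imset _ (inj true)) -(card_imset _ (inj false)).
rewrite -cardsUI (_ : _ :&: _ = set0) ?cards0 ?addn0; last first.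
  apply/setP => t; rewrite !inE; apply/negP => /andP[].
  by move=> /imsetP[s _ ->] /imsetP[s' _ /(congr1 val)].
apply: eq_card => t; rewrite !inE; apply/idP/orP => [|[]].
- case/tupleP: t => b t Pt; case: b Pt => Pt; [left | right];
  by apply/imsetP; exists t; rewrite ?inE.
- by case/imsetP => s; rewrite inE => Ps ->.
by case/imsetP => s; rewrite inE => Ps ->.
Qed.

(** Ballot numbers C(n, m) - C(n, m - 1), for paths with [m] up steps, written without subtraction.
    Splitting on the first step matches Pascal's rule; at height 0 no down step is possible, and its
    term vanishes since C(2m + 1, m + 1) = C(2m + 1, m). *)
Lemma card_excursion n m h : n = 2 * m + h ->
  #|[set t : n.-tuple bool | excursion h t]| +
    (if m is m'.+1 then 'C(n, m') else 0) = 'C(n, m).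
Proof.
elim: n m h => [|n IH] m h e.
  have [-> ->] : m = 0 /\ h = 0 by lia.
  rewrite (_ : [set _ | _] = setT) ?cardsT ?card_tuple //.
  by apply/setP => t; rewrite tuple0 !inE.
rewrite card_tuple_cons.
have -> : #|[set t : n.-tuple bool | excursion h (Up :: t)]|
        = #|[set t : n.-tuple bool | excursion h.+1 t]|.
  by apply: eq_card => t; rewrite !inE /excursion /= addnA addn1.
have D : #|[set t : n.-tuple bool | excursion h (Down :: t)]|
        = if h is h'.+1 then #|[set t : n.-tuple bool | excursion h' t]| else 0.
  case: (h) => [|h']; first by apply: eq_card0 => t; rewrite !inE.
  by apply: eq_card => t; rewrite !inE /excursion /= addSn add0n add1n eqSS.
rewrite D; case: m e => [|m] e.
  rewrite (_ : [set _ | excursion h.+1 _] = set0) ?cards0; last first.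
    apply/setP => t; rewrite !inE; apply/negP => /excursion_size.
    by rewrite size_tuple; lia.
  case: h e {D} => [|h] e; first by lia.
  by have := IH 0 h; rewrite !bin0 => <-; lia.
have := IH m h.+1; rewrite binS; case: h e {D} => [|h] e.
  have eC : 'C(n, m.+1) = 'C(n, m).
    by rewrite -bin_sub; [congr 'C(_, _) |]; lia.
  by rewrite eC; case: m e eC => [|m] e eC; rewrite ?bin0 ?binS; lia.
have := IH m.+1 h; case: m e => [|m] e; rewrite ?bin0 ?binS; lia.
Qed.

Lemma card_Dyck k : k.+1 * #|Dyck k| = 'C(2 * k, k).
Proof.
have -> : #|Dyck k| = #|[set t : (2 * k).-tuple bool | excursion 0 t]|.
  by apply: eq_card => t; rewrite mem_Dyck inE /excursion andbC add0n.
have := @card_excursion (2 * k) k 0 (esym (addn0 _)).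
case: k => [|k]; first by rewrite addn0 mul1n.
(* This is (k + 1) c = (k + 2) d, whence (k + 2) (c - d) = c. *)
have := mul_bin_left (2 * k.+1) k; set c := 'C(_, k.+1); set d := 'C(_, k).
rewrite (_ : 2 * k.+1 - k = k.+2); last by lia.
by set x := #|_|; nia.
Qed.

(** * Dyck paths of V-shaped permutations *)

Lemma word_uniq n (p : 'S_n) : uniq (word p).
Proof.
rewrite map_inj_uniq ?enum_uniq // => i j [] /ord_inj; exact: perm_inj.
Qed.

Lemma word_perm_iota n (p : 'S_n) : perm_eq (word p) (iota 1 n).
Proof.
apply: uniq_perm; rewrite ?word_uniq ?iota_uniq //.
apply: (uniq_min_size (word_uniq p) _ _).2 => //.
  by move=> x /mapP[i _ ->]; rewrite mem_iota add1n !ltnS /=.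
by rewrite size_word size_iota.
Qed.

Lemma word_inj n : injective (@word n).
Proof.
move=> p q e; apply/permP => i; apply: val_inj.
by apply: succn_inj; rewrite -!nth_word e.
Qed.

Lemma word_surj n (w : seq nat) : perm_eq w (iota 1 n) ->
  exists p : 'S_n, word p = w.
Proof.
move=> pw; have sw : size w = n by rewrite (perm_size pw) size_iota.
have lt (i : 'I_n) : (nth 0 w i).-1 < n.
  have : nth 0 w i \in w by apply: mem_nth; rewrite sw.
  by rewrite (perm_mem pw) mem_iota; lia.
have pos (i : 'I_n) : 0 < nth 0 w i.
  have : nth 0 w i \in w by apply: mem_nth; rewrite sw.
  by rewrite (perm_mem pw) mem_iota; lia.
have inj : injective (fun i : 'I_n => Ordinal (lt i)).
  move=> i j [] /(congr1 S); rewrite !prednK // => /eqP.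
  by rewrite nth_uniq ?sw // ?(perm_uniq pw) ?iota_uniq // => /eqP/ord_inj.
exists (perm inj); apply: (@eq_from_nth _ 0); rewrite size_word ?sw // => i ii.
by rewrite (nth_word _ (Ordinal ii)) permE /= prednK // (pos (Ordinal ii)).
Qed.

Lemma word_involutive n (p : 'S_n) :
    (forall i, i < n -> nth 0 (word p) (nth 0 (word p) i).-1 = i.+1) ->
  (p^-1)%g = p.
Proof.
move=> inv; have pK i : p (p i) = i.
  by have := inv i (ltn_ord i); rewrite !nth_word => -[] /ord_inj.
by apply/permP => i; apply: (@perm_inj _ p); rewrite pK permKV.
Qed.

Lemma vshape_block_starts n a b : vshape a b -> perm_eq (a ++ b) (iota 1 n) ->
  block_starts n (rev b).
Proof.
case=> _ pb b0 hb uab pe; apply/and3P; split.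
- move: pb; rewrite -!sorted_pairwise; first by rewrite rev_sorted.
    by move=> p q r /= h1 h2; apply: ltn_trans h1.
  exact: ltn_trans.
- apply/allP => x; rewrite mem_rev => xb.
  by have := perm_mem pe x; rewrite mem_cat xb orbT mem_iota; lia.
apply/implyP => n0; rewrite mem_rev.
have : 1 \in a ++ b by rewrite (perm_mem pe) mem_iota; lia.
rewrite mem_cat => /orP[/(allP hb) h|//].
have : head 0 b \in a ++ b by case: (b) b0 => // y s _; rewrite mem_cat mem_head orbT.
by rewrite (perm_mem pe) mem_iota; lia.
Qed.

(** The values are read from 2k + 1 down to 2; the value 1, which lies in [b] for every V-shaped
    permutation, gets no step. *)
Definition dyck_word k (b : seq nat) : (2 * k).-tuple bool :=
  [tuple ((2 * k).+1 - i \in b) | i < 2 * k].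

Lemma dyck_wordE k b :
  dyck_word k b = [seq (2 * k).+1 - i \in b | i <- iota 0 (2 * k)] :> seq bool.
Proof. by rewrite -val_enum_ord -map_comp. Qed.

Lemma nth_dyck_word k b i : i < 2 * k ->
  nth Down (dyck_word k b) i = ((2 * k).+1 - i \in b).
Proof. by move=> ik; rewrite dyck_wordE (nth_map 0) ?size_iota // nth_iota. Qed.

Lemma updown_lay k b : block_starts (2 * k).+1 (rev b) ->
  updown (lay (2 * k).+1 (rev b)) = dyck_word k b.
Proof.
move=> B; have sz := size_lay B.
apply: (@eq_from_nth _ Down); rewrite size_updown sz ?size_tuple //= => i ik.
rewrite nth_updown sz //; rewrite nth_dyck_word // -(mem_rev b).
have -> : (2 * k).+1 - i.+1 = ((2 * k).+1 - i.+2).+1 by lia.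
rewrite lay_ascent //; last by lia.
by have -> : ((2 * k).+1 - i.+2).+2 = (2 * k).+1 - i by lia.
Qed.

Lemma count_top n (b : seq nat) m : uniq b -> all (fun x => 0 < x <= n) b -> m <= n ->
  count (fun i => n - i \in b) (iota 0 m) = count (leq (n.+1 - m)) b.
Proof.
move=> ub /allP bn mn; rewrite -(count_map (fun i => n - i) (mem b)) -!size_filter.
apply: perm_size; apply: uniq_perm; rewrite ?filter_uniq //.
  rewrite map_inj_in_uniq ?iota_uniq // => i j; rewrite !mem_iota; lia.
move=> x; rewrite !mem_filter /= andbC; case xb: (x \in b); rewrite ?andbF // !andbT.
have /andP[x0 xn] := bn x xb.
apply/mapP/idP => [[i] | h]; first by rewrite mem_iota => im ->; lia.
by exists (n - x); rewrite ?mem_iota; lia.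
Qed.

Lemma vshape_bounds n a b : perm_eq (a ++ b) (iota 1 n) ->
  all (fun x => 0 < x <= n) a /\ all (fun x => 0 < x <= n) b.
Proof.
move=> pe; apply/andP; rewrite -all_cat (perm_all _ pe).
by apply/allP => x; rewrite mem_iota; lia.
Qed.

Lemma ups_dyck_word k a b m : vshape a b ->
    perm_eq (a ++ b) (iota 1 (2 * k).+1) -> m <= 2 * k ->
  ups (take m (dyck_word k b)) = count (leq ((2 * k).+2 - m)) b /\
  downs (take m (dyck_word k b)) = count (leq ((2 * k).+2 - m)) a.
Proof.
move=> [_ _ _ _ uab] pe mk; have [an bn] := vshape_bounds pe.
move: (uab); rewrite cat_uniq => /and3P[ua _ ub].
rewrite dyck_wordE -map_take take_iota (minn_idPl mk) !count_map.
rewrite -(count_top ub bn) -?(count_top ua an); try lia.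
split; apply: eq_in_count => i; rewrite mem_iota //= => im.
have := perm_mem pe ((2 * k).+1 - i); rewrite mem_cat mem_iota.
have -> : 0 < (2 * k).+1 - i < 1 + (2 * k).+1 by lia.
case/orP=> [ia | ib].
  rewrite ia; apply/negP => ib; move: uab.
  by rewrite cat_uniq => /and3P[_ /hasP[]]; exists ((2 * k).+1 - i).
rewrite ib; apply/esym/negP => ia; move: uab.
by rewrite cat_uniq => /and3P[_ /hasP[]]; exists ((2 * k).+1 - i).
Qed.

(** A prefix of length m sees exactly the values from 2k + 2 - m up, so the prefix condition is
    dominance at thresholds above 1. Lower thresholds count all entries and follow from the
    sizes. *)
Lemma dyck_word_Dyck k a b : vshape a b ->
    perm_eq (a ++ b) (iota 1 (2 * k).+1) ->
  dyck_word k b \in Dyck k <-> size b = (size a).+1 /\ dominates a b.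
Proof.
move=> V pe; have H m := @ups_dyck_word k a b m V pe.
have [/allP an /allP bn] := vshape_bounds pe.
have sab : size a + size b = (2 * k).+1.
  by rewrite -size_cat (perm_size pe) size_iota.
have eb : balanced (dyck_word k b) = (size b == (size a).+1).
  have [] := H (2 * k) (leqnn _); rewrite take_oversize ?size_tuple // => _ d.
  have da : downs (dyck_word k b) = size a.
    rewrite d; apply/eqP; rewrite -all_count; apply/allP => x xa.
    case: V => _ _ b0 /allP /(_ x xa) + _.
    by have : 0 < head 0 b; [case: (b) b0 bn => //= y s _ /(_ y (mem_head _ _))|]; lia.
  have e : ups (dyck_word k b) + downs (dyck_word k b) = 2 * k.
    by rewrite -[RHS](size_tuple (dyck_word k b)) count_predC.
  by rewrite /balanced da; rewrite da in e; apply/eqP/eqP; lia.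
rewrite mem_Dyck eb; split.
  case/andP=> /eqP sb /ballotP bal; split=> // v.
  have [v1 | v1] := leqP v 1.
    apply: leq_trans (count_size _ _) _.
    have /eqP -> : count (leq v) b == size b.
      by rewrite -all_count; apply/allP => x /bn; lia.
    by rewrite sb.
  have [vn | vn] := leqP v (2 * k).+1.
    have mk : (2 * k).+2 - v <= 2 * k by lia.
    have := bal ((2 * k).+2 - v); have [-> ->] := H _ mk.
    by rewrite subKn // ltnW.
  rewrite (@eq_in_count _ _ pred0) ?count_pred0 // => x /an.
  by rewrite /=; lia.
case=> -> D; rewrite eqxx /=; apply/ballotP => m.
have [mk|mk] := leqP m (2 * k); first by have [-> ->] := H _ mk; apply: D.
have -> : take m (dyck_word k b) = take (2 * k) (dyck_word k b).
  by rewrite !take_oversize ?size_tuple // ltnW.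
by have [-> ->] := H _ (leqnn (2 * k)); apply: D.
Qed.

Lemma uniquely_sorted_av_vshapeP k (p : 'S_(2 * k).+1) : reflect
  (exists a b, [/\ word p = a ++ b, vshape a b & dyck_word k b \in Dyck k])
  (p \in uniquely_sorted_av (2 * k).+1 [:: [:: 1; 3; 2]; [:: 2; 3; 1]]).
Proof.
have pe := word_perm_iota p; rewrite inE; apply: (iffP andP).
  move=> [us /(peakless_avoids (word_uniq p)) pl].
  have [a [b [e V]]] := peakless_vshape (ltn0Sn _) pe pl.
  exists a, b; split=> //; rewrite e in pe us.
  apply/(dyck_word_Dyck V pe).
  have /uniquely_sortedP[v [ev _]] := us.
  have uv : uniq v by rewrite -stack_sort_uniq ev; case: V.
  move: us; rewrite -ev uniquely_sortedE // ev vshape_balanced // => /eqP sb.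
  by split=> //; apply: vshape_dominates ev.
move=> [a [b [e V]]]; rewrite e in pe * => /(dyck_word_Dyck V pe) [sb D].
have [v ev] := vshape_stack_sorted V sb D.
have uv : uniq v by rewrite -stack_sort_uniq ev; case: V.
split; last by apply/peakless_avoids; [case: V | apply: vshape_peakless].
by rewrite -ev uniquely_sortedE // ev vshape_balanced // sb.
Qed.

Lemma word_swl_vshape n (p : 'S_n) a b : word p = a ++ b -> vshape a b ->
  word (swl p) = lay n (rev b).
Proof.
move=> e V; rewrite word_swl e; apply: slides_vshape => //.
by rewrite -e word_perm_iota.
Qed.

(** Both paths test the same pair of neighbours at each step: [q] is an involution, so its rotation
    is its reversal, whose descents are the ascents of [q] at mirrored positions. *)
Lemma DL_lay k (q : 'S_(2 * k).+1) b :
    block_starts (2 * k).+1 (rev b) -> word q = lay (2 * k).+1 (rev b) ->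
  DL q = (dyck_word k b, dyck_word k b).
Proof.
move=> B e.
have asc i : i < 2 * k -> (nth 0 (word q) (2 * k - i.+1) < nth 0 (word q) (2 * k - i))
    = ((2 * k).+1 - i \in b).
  move=> ik; have -> : 2 * k - i = (2 * k - i.+1).+1 by lia.
  rewrite e lay_ascent //; last by lia.
  by rewrite mem_rev; have -> : (2 * k - i.+1).+2 = (2 * k).+1 - i by lia.
have qV : (q^-1)%g = q.
  by apply: word_involutive => i ik; rewrite e lay_involutive.
rewrite /DL; congr (_, _); apply: eq_from_tnth => i; rewrite !tnth_mktuple -asc //.
  rewrite /is_descent size_word subSS.
  have -> : 0 < 2 * k - i < (2 * k).+1 by have := ltn_ord i; lia.
  have -> : (2 * k - i).-1 = 2 * k - i.+1 by lia.
  have : nth 0 (word q) (2 * k - i.+1) <> nth 0 (word q) (2 * k - i).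
    by apply: nth_neq; rewrite ?word_uniq ?size_word //; have := ltn_ord i; lia.
  by case: (ltngtP (nth 0 (word q) (2 * k - i.+1))).
rewrite /is_descent word_perm_rot qV size_rev size_word.
have ik := ltn_ord i; have -> : 0 < i.+1 < (2 * k).+1 by lia.
rewrite !nth_rev ?size_word; try lia.
by rewrite !subSS; case: ltnP.
Qed.

(** * Recovering the permutation from its Dyck path *)

Lemma vshape_inj a b a' b' n : vshape a b -> vshape a' b' ->
    perm_eq (a ++ b) (iota 1 n) -> perm_eq (a' ++ b') (iota 1 n) ->
  b =i b' -> a ++ b = a' ++ b'.
Proof.
move=> [pa pb _ _ uab] [pa' pb' _ _ uab'] pe pe' eb.
have gtn_tr : transitive gtn by move=> p q r /= h1 h2; apply: ltn_trans h1.
have gtn_irr : irreflexive gtn by move=> p; rewrite /= ltnn.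
rewrite -sorted_pairwise // in pa; rewrite -sorted_pairwise // in pa'.
rewrite -(sorted_pairwise ltn_trans) in pb.
rewrite -(sorted_pairwise ltn_trans) in pb'.
congr (_ ++ _); last exact: (irr_sorted_eq ltn_trans ltnn).
apply: (irr_sorted_eq gtn_tr gtn_irr) => // x.
have H (u w : seq nat) : uniq (u ++ w) -> x \in u = (x \in u ++ w) && (x \notin w).
  rewrite cat_uniq mem_cat => /and3P[_ /hasPn/(_ x) d _].
  by case: (x \in w) d => [/(_ isT) /negbTE -> |]; rewrite ?andbF ?orbF ?andbT.
by rewrite (H _ _ uab) (H _ _ uab') (perm_mem pe) (perm_mem pe') eb.
Qed.

Lemma vshape_of_dyck_word k (t : (2 * k).-tuple bool) : exists a b,
  [/\ vshape a b, perm_eq (a ++ b) (iota 1 (2 * k).+1) & dyck_word k b = t].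
Proof.
(* The value x is read at index 2k + 1 - x. For x = 1 this index falls outside [t], so 1 is put into
   [b] separately. *)
pose P x := (x == 1) || nth Down t ((2 * k).+1 - x).
pose b := [seq x <- iota 1 (2 * k).+1 | P x].
pose a := rev [seq x <- iota 1 (2 * k).+1 | ~~ P x].
have eb : b = 1 :: behead b by [].
have gtn_tr : transitive gtn by move=> p q r /= h1 h2; apply: ltn_trans h1.
have pe : perm_eq (a ++ b) (iota 1 (2 * k).+1).
  rewrite perm_catC; apply: perm_trans (permEl (perm_filterC P _)).
  by rewrite perm_cat2l perm_rev.
exists a, b; split=> //.
  split=> //.
  - rewrite -sorted_pairwise // rev_sorted.
    by apply: (sorted_filter ltn_trans); apply: iota_ltn_sorted.
  - rewrite -(sorted_pairwise ltn_trans).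
    by apply: (sorted_filter ltn_trans); apply: iota_ltn_sorted.
  - rewrite eb; apply/allP => x; rewrite mem_rev mem_filter negb_or mem_iota /=.
    by lia.
  - by rewrite (perm_uniq pe) iota_uniq.
apply: eq_from_tnth => i; rewrite tnth_mktuple mem_filter mem_iota /P.
have ik := ltn_ord i; rewrite subKn ?(tnth_nth Down); last by lia.
have -> : ((2 * k).+1 - i == 1) = false by apply/eqP; lia.
have -> : 0 < (2 * k).+1 - i < 1 + (2 * k).+1 by lia.
by rewrite andbT.
Qed.

Theorem theorem9p3 (k : nat) :
  let A := uniquely_sorted_av (2 * k).+1 [:: [:: 1; 3; 2]; [:: 2; 3; 1]] in
  let f := fun p : 'S_(2 * k).+1 => DL (swl p) in
  let IntA := intervals (Dyck k) (@antichain_le _) in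
  [/\ {in A, forall p, swl p \in uniquely_sorted_av (2 * k).+1 [:: [:: 3; 1; 2]]},
      {in A &, injective f},
      f @: A = IntA,
      IntA = [set (w, w) | w in Dyck k]
    & (#|A|%:R = (k.+1%:R)^-1 * 'C(2 * k, k)%:R :> rat)%R].
Proof.
move=> A f IntA.
have eInt : IntA = [set (w, w) | w in Dyck k].
  apply/setP => -[x y]; rewrite inE /antichain_le /=.
  apply/and3P/imsetP => [[xD _ /eqP <-] | [w wD [-> ->]]]; first by exists x.
  by rewrite wD eqxx.
have fE (p : 'S_(2 * k).+1) a b : word p = a ++ b -> vshape a b ->
    f p = (dyck_word k b, dyck_word k b).
  move=> e V; apply: DL_lay; last exact: word_swl_vshape e V.
  by apply: (vshape_block_starts V); rewrite -e word_perm_iota.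
have inj : {in A &, injective f}.
  move=> p p' /uniquely_sorted_av_vshapeP[a [b [e V _]]].
  move=> /uniquely_sorted_av_vshapeP[a' [b' [e' V' _]]].
  rewrite (fE _ _ _ e V) (fE _ _ _ e' V') => /(congr1 fst) /= eb.
  have pe := word_perm_iota p; have pe' := word_perm_iota p'.
  rewrite e in pe; rewrite e' in pe'.
  apply: word_inj; rewrite e e'; apply: (vshape_inj V V' pe pe') => x.
  have := vshape_block_starts V pe; have := vshape_block_starts V' pe'.
  rewrite /block_starts !mem_rev => /and3P[_ /allP bn' b1'] /and3P[_ /allP bn b1].
  (* The path does not show the value 1, but both increasing parts contain it. *)
  have [x1|x1] := eqVneq x 1; first by rewrite x1 (b1 : 1 \in b) (b1' : 1 \in b').
  have [xn|xn] := boolP (1 < x <= (2 * k).+1); last first.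
    apply/idP/idP => [h|h].
      by have := bn x; rewrite mem_rev h => /(_ isT); lia.
    by have := bn' x; rewrite mem_rev h => /(_ isT); lia.
  have xk : (2 * k).+1 - x < 2 * k by lia.
  have := nth_dyck_word b xk; rewrite eb nth_dyck_word //.
  by rewrite subKn //; lia.
have im : f @: A = IntA.
  rewrite eInt; apply/setP => z; apply/imsetP/imsetP.
    case=> p /uniquely_sorted_av_vshapeP[a [b [e V D]]] ->.
    by exists (dyck_word k b) => //; apply: fE e V.
  case=> t tD ->; have [a [b [V pe et]]] := vshape_of_dyck_word t.
  have [p ep] := word_surj pe; exists p; last by rewrite (fE p a b ep V) et.
  by apply/uniquely_sorted_av_vshapeP; exists a, b; rewrite et.
split=> //.
  move=> p /uniquely_sorted_av_vshapeP[a [b [e V D]]].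
  have B : block_starts (2 * k).+1 (rev b).
    by apply: (vshape_block_starts V); rewrite -e word_perm_iota.
  have L := lay_layered B.
  (* The Dyck path of the V is also the step word of its layered image, so [layered_stack_sorted]
     applies. *)
  move: D; rewrite mem_Dyck -(updown_lay B) => /andP[bal ball].
  rewrite inE (word_swl_vshape e V) /= layered_avoids // !andbT.
  have [|v ev] := layered_stack_sorted _ L ball bal; first by rewrite size_lay.
  rewrite -ev uniquely_sortedE ?ev //.
  by rewrite -stack_sort_uniq ev -(word_swl_vshape e V) word_uniq.
have cA : #|A| = #|Dyck k|.
  by rewrite -(card_in_imset inj) im eInt card_imset // => x y [].
apply: (@GRing.mulfI _ (k.+1%:R)%R); first by rewrite Num.Theory.pnatr_eq0.
rewrite GRing.mulrA GRing.divff ?Num.Theory.pnatr_eq0 // GRing.mul1r cA.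
by rewrite -GRing.natrM card_Dyck.
Qed.
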